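(* Consider the SEMRPP problem in the continuous model (defined in the context) in the case where all tasks have equal execution cycles ($w_1=\dots=w_n$). The algorithm ECSEMRPP\_Algo finds an optimal schedule in $O(mn^3\log n)$ time.
   Context: SEMRPP: $n$ independent tasks $J_1,\dots,J_n$ with work $w_j>0$, $m$ processors $\mathcal{P}=\{P_1,\dots,P_m\}$, each task with a nonempty eligibility set $\mathcal{M}_j\subseteq\mathcal{P}$; each task must run non-migratorily on one eligible processor; common deadline $C$; everything available at time 0. Continuous model: speeds in $[s_{min},s_{max}]$, speed $s$ costs power $s^\alpha$ with constant $\alpha>1$; work is the integral of speed and energy the integral of power; minimize total energy. Equivalently (under the paper's standing assumption that no processor needs to run below $s_{min}$), choose $x_{ij}\in\{0,1\}$ with $x_{ij}=0$ if $P_i\notin\mathcal{M}_j$, $\sum_i x_{ij}=1$ for all $j$, $\sum_j x_{ij}w_j\le s_{max}C$ for all $i$, minimizing $\sum_{i=1}^m(\sum_j x_{ij}w_j)^\alpha/C^{\alpha-1}$; each processor runs at constant speed (its load)/$C$. ECSEMRPP\_Algo: repeatedly, on the current set of remaining tasks and processors, compute an assignment minimizing the maximum number of tasks per processor (via binary search over a capacity $c$ on source-to-processor arcs in the flow network source$\to P_i$ (capacity $c$), $P_i\to J_j$ for $P_i\in\mathcal{M}_j$ (capacity 1), $J_j\to$sink (capacity 1), using maximum flow); take a processor with maximum load in that assignment together with its assigned tasks, fix this assignment, remove that processor and its tasks (and incident edges), and repeat until nothing remains; finally run each processor at speed equal to its total assigned work divided by $C$.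
   Formalization: With an arbitrary min-max assignment the algorithm can be non-optimal; here each round's assignment is fixed as a maximum flow for the least sufficient capacity c, obtained by augmenting (BFS paths) a maximum flow for capacity c-1. The time bound is stated for n at least 2. *)

(* Defs.v *)
From HB Require Import structures.
From Stdlib Require Import String.
From mathcomp Require Import all_boot all_order all_algebra.
From mathcomp Require Import all_classical all_reals all_analysis.

Set Implicit Arguments.
Unset Strict Implicit.
Unset Printing Implicit Defensive.

Import Order.TTheory GRing.Theory Num.Theory.
Import numFieldNormedType.Exports.

(** * The scheduling problem *)

Section Problem.
Local Open Scope classical_set_scope.
Local Open Scope ring_scope.
Context {R : realType} {m n : nat}.

Record instance := Instance {
  work : 'I_n -> R;
  eligible : 'I_n -> {set 'I_m};
  deadline : R;
  smin : R;
  smax : R;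
  alpha : R;
  work_gt0 : forall j, 0 < work j;
  eligible_ex : forall j, exists i, i \in eligible j;
  deadline_gt0 : 0 < deadline;
  smin_ge0 : 0 <= smin;
  smin_le_smax : smin <= smax;
  alpha_gt1 : 1 < alpha }.

(* At time t, processor i executes the task [running i t] (it idles if this is
   [None]) at speed [speed i t]. Only times in [0, deadline] are meaningful. *)
Record schedule := Schedule {
  host : 'I_n -> 'I_m;
  running : 'I_m -> R -> option 'I_n;
  speed : 'I_m -> R -> R }.

Variable I : instance.

Definition horizon : set R := `[0, deadline I].

(* Preemption within a processor is allowed; migration is not. Idling costs
   nothing, the speed range only binds a processor that executes a task. *)
Record feasible (S : schedule) : Prop := Feasible {
  feasible_host : forall j, host S j \in eligible I j;
  feasible_nonmigratory : forall i j t, horizon t ->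
    running S i t = Some j -> host S j = i;
  feasible_speed : forall i j t, horizon t ->
    running S i t = Some j -> smin I <= speed S i t <= smax I;
  feasible_idle : forall i t, horizon t ->
    running S i t = None -> speed S i t = 0;
  feasible_measurable_running : forall i j,
    measurable (horizon `&` [set t | running S i t = Some j]);
  feasible_measurable_speed : forall i, measurable_fun horizon (speed S i);
  feasible_work : forall j,
    (\int[lebesgue_measure]_(t in
        horizon `&` [set t | running S (host S j) t = Some j])
       (speed S (host S j) t)%:E = (work I j)%:E)%E }.

Definition energy (S : schedule) : \bar R :=
  (\sum_(i < m)
     \int[lebesgue_measure]_(t in horizon) ((speed S i t) `^ alpha I)%:E)%E.

Definition optimal (S : schedule) : Prop :=
  feasible S /\ forall S', feasible S' -> (energy S <= energy S')%E.

(** The assignment (integer program) form, where a processor runs at the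
    constant speed load / deadline and [smin] is left out. *)

Definition load (a : 'I_n -> 'I_m) (i : 'I_m) : R :=
  \sum_(j < n | a j == i) work I j.

Definition admissible (a : 'I_n -> 'I_m) : Prop :=
  (forall j, a j \in eligible I j) /\
  (forall i, load a i <= smax I * deadline I).

Definition assignment_energy (a : 'I_n -> 'I_m) : R :=
  \sum_(i < m) load a i `^ alpha I / deadline I `^ (alpha I - 1).

Definition optimal_assignment (a : 'I_n -> 'I_m) : Prop :=
  admissible a /\
  forall b, admissible b -> assignment_energy a <= assignment_energy b.

(* The standing assumption that no processor needs to run below [smin],
   imposed only on the optimal assignments and on the processors in use. *)
Definition smin_not_binding : Prop :=
  forall a, optimal_assignment a ->
  forall i, 0 < load a i -> smin I <= load a i / deadline I.

(** The schedule in which every processor i executes the tasks assigned to it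
    one after the other, by increasing index, from time 0, at the constant
    speed v i. *)

Definition start_time (a : 'I_n -> 'I_m) (v : 'I_m -> R) (j : 'I_n) : R :=
  (\sum_(k < n | (k < j)%N && (a k == a j)) work I k) / v (a j).

Definition constant_speed_running (a : 'I_n -> 'I_m) (v : 'I_m -> R)
    (i : 'I_m) (t : R) : option 'I_n :=
  [pick j | (a j == i) &&
     (start_time a v j <= t < start_time a v j + work I j / v i)].

Definition constant_speed_schedule (a : 'I_n -> 'I_m) (v : 'I_m -> R) :
    schedule :=
  {| host := a;
     running := constant_speed_running a v;
     speed := fun i t =>
       if constant_speed_running a v i t is Some _ then v i else 0 |}.

End Problem.
Arguments instance : clear implicits.
Arguments schedule : clear implicits.

(** * A random access machine with unit-cost operations *)

(* The memory consists of named arrays of natural numbers and named arrays of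
   reals. A scalar variable is cell 0 of the array of the same name. *)

Inductive expr :=
| Cst of nat
| Get of string & expr
| Add of expr & expr
| Mul of expr & expr
| Half of expr
| Lt of expr & expr
| Eq of expr & expr
| And of expr & expr.

Inductive rexpr :=
| RZero
| RGet of string & expr
| RAdd of rexpr & rexpr
| RDiv of rexpr & rexpr.

Inductive cmd :=
| Skip
| Put of string & expr & expr     (* array, index, value *)
| RPut of string & expr & rexpr
| Seq of cmd & cmd
| If of expr & cmd & cmd
| While of expr & cmd.

Section Semantics.
Context {R : realType}.

Record state := State {
  nmem : string -> nat -> nat;
  rmem : string -> nat -> R }.

Definition update (T : Type) (f : string -> nat -> T) (x : string) (k : nat)
    (v : T) : string -> nat -> T :=
  fun y l => if String.eqb y x && (l == k) then v else f y l.

Definition nput (s : state) x k v := State (update (nmem s) x k v) (rmem s).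
Definition rput (s : state) x k v := State (nmem s) (update (rmem s) x k v).

Fixpoint eval (s : state) (e : expr) : nat :=
  match e with
  | Cst k => k
  | Get x e1 => nmem s x (eval s e1)
  | Add e1 e2 => eval s e1 + eval s e2
  | Mul e1 e2 => eval s e1 * eval s e2
  | Half e1 => (eval s e1)./2
  | Lt e1 e2 => nat_of_bool (eval s e1 < eval s e2)
  | Eq e1 e2 => nat_of_bool (eval s e1 == eval s e2)
  | And e1 e2 => nat_of_bool ((eval s e1 != 0) && (eval s e2 != 0))
  end.

Fixpoint reval (s : state) (e : rexpr) : R :=
  match e with
  | RZero => 0%R
  | RGet x e1 => rmem s x (eval s e1)
  | RAdd e1 e2 => (reval s e1 + reval s e2)%R
  | RDiv e1 e2 => (reval s e1 / reval s e2)%R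
  end.

Fixpoint cost (e : expr) : nat :=
  match e with
  | Cst _ => 1
  | Get _ e1 | Half e1 => (cost e1).+1
  | Add e1 e2 | Mul e1 e2 | Lt e1 e2 | Eq e1 e2 | And e1 e2 =>
      (cost e1 + cost e2).+1
  end.

Fixpoint rcost (e : rexpr) : nat :=
  match e with
  | RZero => 1
  | RGet _ e1 => (cost e1).+1
  | RAdd e1 e2 | RDiv e1 e2 => (rcost e1 + rcost e2).+1
  end.

(* [exec c s t s']: started in s, c terminates in s' after t steps. *)
Inductive exec : cmd -> state -> nat -> state -> Prop :=
| exec_skip s : exec Skip s 1 s
| exec_put x e1 e2 s :
    exec (Put x e1 e2) s (cost e1 + cost e2).+1
         (nput s x (eval s e1) (eval s e2))
| exec_rput x e1 e2 s :
    exec (RPut x e1 e2) s (cost e1 + rcost e2).+1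
         (rput s x (eval s e1) (reval s e2))
| exec_seq c1 c2 s t1 s1 t2 s2 :
    exec c1 s t1 s1 -> exec c2 s1 t2 s2 -> exec (Seq c1 c2) s (t1 + t2) s2
| exec_if_true e c1 c2 s t s' :
    eval s e != 0 -> exec c1 s t s' -> exec (If e c1 c2) s (cost e + t).+1 s'
| exec_if_false e c1 c2 s t s' :
    eval s e = 0 -> exec c2 s t s' -> exec (If e c1 c2) s (cost e + t).+1 s'
| exec_while_true e c s t1 s1 t2 s2 :
    eval s e != 0 -> exec c s t1 s1 -> exec (While e c) s1 t2 s2 ->
    exec (While e c) s (cost e + t1 + t2).+1 s2
| exec_while_false e c s :
    eval s e = 0 -> exec (While e c) s (cost e).+1 s.

Lemma exec_det c s t1 s1 t2 s2 :
  exec c s t1 s1 -> exec c s t2 s2 -> t1 = t2 /\ s1 = s2.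
Proof.
move=> H; elim: H t2 s2 => {c s t1 s1};
  intros; match goal with H : exec _ _ _ _ |- _ => inversion H; subst end;
  repeat match goal with
  | IH : forall t s, exec ?c ?s0 t s -> _, H : exec ?c ?s0 _ _ |- _ =>
      case: (IH _ _ H) => ? ?; subst; clear IH
  | E : is_true (?x != 0), E0 : ?x = 0 |- _ => by rewrite E0 in E
  end; by [].
Qed.

End Semantics.
Arguments state : clear implicits.

(** * ECSEMRPP_Algo *)

Definition Var (x : string) : expr := Get x (Cst 0).
Definition Set_ (x : string) (e : expr) : cmd := Put x (Cst 0) e.
Definition For (x : string) (e : expr) (c : cmd) : cmd :=
  Seq (Set_ x (Cst 0))
    (While (Lt (Var x) e) (Seq c (Set_ x (Add (Var x) (Cst 1))))).

Declare Scope imp_scope.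
Delimit Scope imp_scope with imp.
Bind Scope imp_scope with expr.
Bind Scope imp_scope with cmd.
Coercion Var : string >-> expr.
Coercion Cst : nat >-> expr.
Notation "x '#' e" := (Get x e) (at level 9, e at level 9) : imp_scope.
Notation "e1 + e2" := (Add e1 e2) : imp_scope.
Notation "e1 * e2" := (Mul e1 e2) : imp_scope.
Notation "e1 < e2" := (Lt e1 e2) : imp_scope.
Notation "e1 == e2" := (Eq e1 e2) : imp_scope.
Notation "e1 && e2" := (And e1 e2) : imp_scope.
Notation "x '<~' e" := (Set_ x e) (at level 75, no associativity) : imp_scope.
Notation "x '##' e1 '<~' e2" := (Put x e1 e2)
  (at level 75, e1 at level 9, no associativity) : imp_scope.
Notation "c1 ;; c2" := (Seq c1 c2) (at level 80, right associativity) :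
  imp_scope.

Section Program.
Local Open Scope string_scope.
Local Open Scope nat_scope.
Local Open Scope imp_scope.

(* Input: n, m, elig#(i * n + j) (1 if processor i is eligible for task j,
   else 0), the works w#j and the deadline C.
   Output: proc#j, the processor of task j, and speed#i.
   pdone and tdone mark the processors and tasks already removed; rem is the
   number of remaining tasks.

   An integral flow in the network
     source -> P_i (capacity c), P_i -> J_j (capacity 1 if eligible),
     J_j -> sink (capacity 1)
   on the remaining processors and tasks is stored as load#i, the flow on
   source -> P_i, and asg#j, the processor that sends a unit to J_j, or m if
   there is none; val is the flow value. *)

Definition zero_flow : cmd :=
  For "i" "m" ("load"##"i" <~ 0) ;;
  For "j" "n" ("asg"##"j" <~ "m") ;;
  "val" <~ 0.

(* Breadth-first search of the residual network from the source. from#i is the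
   task through which P_i was reached, or n if it was reached from the source;
   tfrom#j is the processor through which J_j was reached; last is the task
   from which the sink was reached. *)
Definition find_augmenting_path : cmd :=
  "found" <~ 0 ;; "qhead" <~ 0 ;; "qtail" <~ 0 ;;
  For "j" "n" ("tseen"##"j" <~ 0) ;;
  For "i" "m" (
    "pseen"##"i" <~ 0 ;;
    If (("pdone"#"i" == 0) && ("load"#"i" < "c")) (
      "pseen"##"i" <~ 1 ;; "from"##"i" <~ "n" ;;
      "queue"##"qtail" <~ "i" ;; "qtail" <~ "qtail" + 1)
    Skip) ;;
  While (("found" == 0) && ("qhead" < "qtail")) (
    "i" <~ "queue"#"qhead" ;; "qhead" <~ "qhead" + 1 ;;
    "j" <~ 0 ;;
    While (("found" == 0) && ("j" < "n")) (
      If (("elig"#("i" * "n" + "j") == 1) && ("tdone"#"j" == 0) &&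
          ("tseen"#"j" == 0) && (("asg"#"j" == "i") == 0)) (
        "tseen"##"j" <~ 1 ;; "tfrom"##"j" <~ "i" ;;
        "k" <~ "asg"#"j" ;;
        If ("k" == "m") ("found" <~ 1 ;; "last" <~ "j") (
          If ("pseen"#"k" == 0) (
            "pseen"##"k" <~ 1 ;; "from"##"k" <~ "j" ;;
            "queue"##"qtail" <~ "k" ;; "qtail" <~ "qtail" + 1)
          Skip))
      Skip ;;
      "j" <~ "j" + 1)).

Definition augment : cmd :=
  "j" <~ "last" ;; "i" <~ "tfrom"#"j" ;; "asg"##"j" <~ "i" ;;
  While ("from"#"i" < "n") (
    "j" <~ "from"#"i" ;; "i" <~ "tfrom"#"j" ;; "asg"##"j" <~ "i") ;;
  "load"##"i" <~ "load"#"i" + 1 ;;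
  "val" <~ "val" + 1.

(* Turns the current flow into a maximum flow for the capacity c. *)
Definition max_flow : cmd :=
  "found" <~ 1 ;;
  While "found" (
    find_augmenting_path ;;
    If "found" augment Skip).

(* The capacity lo is too small to route all remaining tasks, hi is not. The
   final maximum flow for the least sufficient capacity hi = lo + 1 is obtained
   by augmenting a maximum flow for the capacity lo; starting from the zero
   flow could overload a processor that does not have to carry hi tasks, and
   fixing such a processor would lose optimality. *)
Definition min_max_assignment : cmd :=
  "lo" <~ 0 ;; "hi" <~ "rem" ;;
  While ("lo" + 1 < "hi") (
    "c" <~ Half ("lo" + "hi") ;;
    zero_flow ;; max_flow ;;
    If ("val" == "rem") ("hi" <~ "c") ("lo" <~ "c")) ;;
  zero_flow ;;
  "c" <~ "lo" ;; max_flow ;;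
  "c" <~ "hi" ;; max_flow.

Definition fix_max_load_processor : cmd :=
  "p" <~ 0 ;; "best" <~ 0 ;;
  For "i" "m" (
    If (("pdone"#"i" == 0) && ("best" < "load"#"i"))
      ("p" <~ "i" ;; "best" <~ "load"#"i") Skip) ;;
  "pdone"##"p" <~ 1 ;;
  "left" <~ 0 ;;
  For "j" "n" (
    If ("tdone"#"j" == 0) (
      If ("asg"#"j" == "p")
        ("tdone"##"j" <~ 1 ;; "proc"##"j" <~ "p")
        ("left" <~ "left" + 1))
    Skip) ;;
  "rem" <~ "left".

Definition set_speeds : cmd :=
  For "i" "m" (RPut "total" "i" RZero) ;;
  For "j" "n" (RPut "total" ("proc"#"j")
    (RAdd (RGet "total" ("proc"#"j")) (RGet "w" "j"))) ;;
  For "i" "m" (RPut "speed" "i" (RDiv (RGet "total" "i") (RGet "C" 0))).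

Definition ECSEMRPP_Algo : cmd :=
  For "i" "m" ("pdone"##"i" <~ 0) ;;
  For "j" "n" ("tdone"##"j" <~ 0) ;;
  "rem" <~ "n" ;;
  While "rem" (min_max_assignment ;; fix_max_load_processor) ;;
  set_speeds.

End Program.

Section InputOutput.
Local Open Scope string_scope.
Local Open Scope nat_scope.
Context {R : realType} {m n : nat}.

(* The memory outside the input cells is arbitrary. *)
Record encodes (I : instance R m n) (s : state R) : Prop := Encodes {
  encodes_m : nmem s "m" 0 = m;
  encodes_n : nmem s "n" 0 = n;
  encodes_elig : forall (i : 'I_m) (j : 'I_n),
    nmem s "elig" (i * n + j) = nat_of_bool (i \in eligible I j);
  encodes_w : forall j : 'I_n, rmem s "w" j = work I j;
  encodes_C : rmem s "C" 0 = deadline I }.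

Record returns (s : state R) (a : 'I_n -> 'I_m) (v : 'I_m -> R) : Prop :=
  Returns {
  returns_proc : forall j : 'I_n, nmem s "proc" j = a j;
  returns_speed : forall i : 'I_m, rmem s "speed" i = v i }.

End InputOutput.

(* Main.v *)
(* Write [cnt b i] for the number of tasks that the assignment [b] puts on the
   processor [i], and [excess d b] for the sum over i of (cnt b i - d)^+. With
   equal works, the energy is a convex function of the counts, hence a
   nonnegative combination of the [excess d] plus a constant, and by Jensen's
   inequality running at constant speed is best for a given assignment. So it
   suffices that the computed assignment minimizes [excess d] for all d at once.

   The rounds keep the following invariant: for every d, every eligible
   assignment can be turned into one that agrees with the choices made so far
   without increasing [excess d]. In a round let lo + 1 be the least sufficient
   capacity, and let B be the set of processors that the search does not reach
   after the maximum flow for capacity lo. The processors of B carry lo or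
   lo + 1 tasks each, and the tasks on B are eligible only on B; hence an
   assignment may be replaced by the computed one for these tasks, while its
   other tasks are evicted from B. This does not increase [excess d] if
   d <= lo, and for larger d the computed assignment has no excess at all; either
   way the assignment now agrees with the computed one on a processor of load
   lo + 1, which is the one that the round fixes.

   Every augmentation assigns one more task, so a maximum flow takes at most
   n + 1 searches of cost O(mn); there are O(log n) flows in each of at most n
   rounds. *)
From Pilot Require Import Defs.
From Stdlib Require Import String.
From mathcomp Require Import all_boot all_order all_algebra.
From mathcomp Require Import all_classical all_reals all_analysis.
From mathcomp Require Import measurable_realfun zify ring lra.
Import Pilot.Defs.

Set Implicit Arguments.
Unset Strict Implicit.
Unset Printing Implicit Defensive.

Import Order.TTheory GRing.Theory Num.Theory.

(** * Assignments and flows *)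

Section Assignments.
Local Open Scope nat_scope.
Variables (m n : nat) (el : nat -> nat -> bool).
Implicit Types (f g b : nat -> nat) (P T A B : pred nat).

Definition cnt f i := \sum_(j < n) (f j == i).

Definition excess d f := \sum_(i < m) (cnt f i - d).

Definition legal b := forall j, j < n -> b j < m /\ el (b j) j.

(* The value m means that a task is not assigned. *)
Definition flow P T f := forall j, j < n ->
  f j = m \/ [/\ f j < m, P (f j), T j & el (f j) j].

Definition covers T f := forall j, j < n -> T j -> f j < m.

Definition sufficient P T c :=
  exists2 f, flow P T f /\ covers T f & forall i, i < m -> cnt f i <= c.

(* A is the source side of a minimum cut for capacity c. *)
Definition source_cut P T c f A :=
  [/\ forall i, i < m -> P i -> cnt f i < c -> A i,
      forall i, i < m -> A i -> P i
    & forall i j, i < m -> j < n -> A i -> T j -> el i j ->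
        f j < m /\ A (f j)].

(** Double counting of the pairs of a task and its host in [B]; the guard [f j < m] discards
    unassigned tasks. *)
Lemma sum_fibre B f :
  \sum_(i < m | B i) cnt f i = \sum_(j < n) ((f j < m) && B (f j)).
Proof.
rewrite exchange_big; apply: eq_bigr => j _ /=.
case: (ltnP (f j) m) => [lt|ge] /=; last first.
  by rewrite big1 // => i _; case: eqP => // E; have := ltn_ord i; lia.
rewrite big_mkcond (bigD1 (Ordinal lt)) //= eqxx big1 ?addn0; first by case: (B _).
move=> i ne; case: eqP => [E|_]; last by case: (B _).
by case/eqP: ne; apply: val_inj.
Qed.

Lemma sum_cnt f : (forall j, j < n -> f j < m) -> \sum_(i < m) cnt f i = n.
Proof.
move=> H; rewrite (sum_fibre predT) (eq_bigr (fun _ => 1)) ?sum1_card ?card_ord //.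
by move=> j _; rewrite H.
Qed.

(** Outside [A] every processor is saturated by [f], so [g] places at most as many tasks there as
    [f] does. But the closure of [A] keeps every task that [f] places outside [A] outside under [g],
    and the task missed by [f] joins them. *)
Lemma cut_insufficient P T c f A : flow P T f -> ~ covers T f ->
  source_cut P T c f A -> ~ sufficient P T c.
Proof.
move=> ff nf [A1 A2 A3] [g [fg cg] gc].
pose B i := P i && ~~ A i.
have le1 : \sum_(i < m | B i) c <= \sum_(i < m | B i) cnt f i.
  apply: leq_sum => i /andP[Pi nA]; rewrite leqNgt; apply: contra nA => lt.
  exact: A1.
have le2 : \sum_(i < m | B i) cnt g i <= \sum_(i < m | B i) c.
  by apply: leq_sum => i _; apply: gc.
apply: nf => j jn Tj; rewrite ltnNge; apply/negP => mj.
have : \sum_(i < m | B i) cnt f i < \sum_(i < m | B i) cnt g i; last by lia.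
rewrite !sum_fibre.
have fgB k : k < n -> (f k < m) && B (f k) -> (g k < m) && B (g k).
  move=> kn /andP[fk /andP[Pf nA]]; case: (ff k kn) => [E|[_ _ Tk _]]; first lia.
  have gk := cg k kn Tk; rewrite gk /=.
  case: (fg k kn) => [E|[_ Pg _ eg]]; first lia.
  rewrite /B Pg /=; apply: contra nA => Ag.
  by case: (A3 (g k) k gk kn Ag Tk eg).
rewrite (bigD1 (Ordinal jn)) //= [ltnRHS](bigD1 (Ordinal jn)) //=.
have -> : f j < m = false by lia.
have gj := cg j jn Tj.
have -> : (g j < m) && B (g j).
  rewrite gj /=; case: (fg j jn) => [E|[_ Pg _ eg]]; first lia.
  rewrite /B Pg /=; apply/negP => Ag.
  by case: (A3 (g j) j gj jn Ag Tj eg); lia.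
rewrite add0n add1n ltnS; apply: leq_sum => k _.
by have := fgB k (ltn_ord k); case: (_ && _) => // ->.
Qed.

(* The loads of A cannot grow from f to f', since A already carries all tasks
   that are eligible on it; so B, the rest, is closed and carries lo or lo + 1
   tasks per processor. *)
Lemma cut_extend P T lo f f' A :
  flow P T f -> (forall i, i < m -> cnt f i <= lo) ->
  source_cut P T lo f A -> flow P T f' -> covers T f' ->
  (forall i, i < m -> cnt f i <= cnt f' i) ->
  let B i := P i && ~~ A i in
  [/\ forall i j, i < m -> j < n -> T j -> P i -> el i j -> B (f' j) -> B i,
      forall i, i < m -> B i -> lo <= cnt f' i
    & forall i, i < m -> P i -> ~~ B i -> cnt f' i <= lo].
Proof.
move=> ff flo [A1 A2 A3] ff' cf' mono B.
have pw (j : 'I_n) : ((f' j < m) && A (f' j) : nat) <=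
    ((f j < m) && A (f j)) ?= iff
    (((f' j < m) && A (f' j)) == ((f j < m) && A (f j))).
  split; last by case: (_ && _); case: (_ && _).
  case E: (_ && _) => //; case/andP: E => f'j Af'.
  case: (ff' j (ltn_ord j)) => [E|[_ _ Tj e]]; first lia.
  by case: (A3 _ j f'j (ltn_ord j) Af' Tj e) => -> ->.
have pw' (i : 'I_m) : A i -> cnt f i <= cnt f' i ?= iff (cnt f i == cnt f' i).
  by split=> //; apply: mono.
have S1 := leqif_sum (fun j (_ : predT j) => pw j).
have S2 := @leqif_sum 'I_m (fun i => A i) _ _ _ pw'.
rewrite !sum_fibre in S2.
(* Tasks on [A] can only become fewer, loads on [A] can only grow; so the two totals agree, and both
   inequalities are equalities term by term. *)
have E := anti_leq (introT andP (conj (S1 : _ <= _) (S2 : _ <= _))).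
have [_ /esym] := S1; rewrite E eqxx => /forall_inP E1.
have [_ /esym] := S2; rewrite E eqxx => /forall_inP E2.
split.
- move=> i j im jn Tj Pi e /andP[_ nA]; rewrite /B Pi /=; apply: contra nA => Ai.
  have [a b] := A3 i j im jn Ai Tj e.
  by have /eqP := E1 (Ordinal jn) isT; rewrite /= a b => /andP[].
- move=> i im /andP[Pi nA]; apply: leq_trans (mono i im).
  by rewrite leqNgt; apply: contra nA; apply: A1.
- move=> i im Pi; rewrite /B Pi /= negbK => Ai.
  by have /eqP <- := E2 (Ordinal im) Ai; apply: flo.
Qed.

Lemma excess_exchange P T B lo f p d b :
  flow P T f -> covers T f ->
  (forall i, i < m -> B i -> P i) ->
  (forall i j, i < m -> j < n -> T j -> P i -> el i j -> B (f j) -> B i) ->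
  (forall i, i < m -> B i -> lo <= cnt f i) ->
  (forall i, i < m -> P i -> ~~ B i -> cnt f i <= lo) ->
  (forall i, i < m -> P i -> cnt f i <= lo.+1) ->
  p < m -> P p -> cnt f p = lo.+1 ->
  legal b -> (forall j, j < n -> T j = P (b j)) ->
  exists b', [/\ legal b', forall j, j < n -> ~~ T j -> b' j = b j,
    forall j, j < n -> T j -> P (b' j) /\ (b' j == p) = (f j == p)
    & excess d b' <= excess d b].
Proof.
move=> ff cf BP Bcl Blo Ahi hi pm Pp cp lb TP.
have fP j : j < n -> T j -> [/\ f j < m, P (f j) & el (f j) j].
  by move=> jn Tj; have := cf j jn Tj; case: (ff j jn) => [->|[]//]; rewrite ltnn.
have fN j : j < n -> ~~ T j -> f j = m.
  by move=> jn Tj; case: (ff j jn) => [//|[_ _]]; rewrite (negbTE Tj).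
have Bp : B p by apply/negPn/negP => /(Ahi p pm Pp); lia.
have [lt|ge] := ltnP lo d.
  exists (fun j => if T j then f j else b j); split.
  - by move=> j jn; case: ifP => Tj; [case: (fP j jn Tj)|apply: lb].
  - by move=> j jn /negbTE ->.
  - by move=> j jn Tj; rewrite Tj; case: (fP j jn Tj).
  apply: leq_sum => i _; case Pi: (P i).
    suff: cnt (fun j => if T j then f j else b j) i <= cnt f i.
      by have := hi i (ltn_ord i) Pi; lia.
    apply: leq_sum => j _; case: ifP => Tj //.
    case: eqP => // E; move: Tj; rewrite (TP j (ltn_ord j)) E Pi //.
  suff -> : cnt (fun j => if T j then f j else b j) i = cnt b i by [].
  apply: eq_bigr => j _; case: ifP => Tj //.
  have [_ Pf _] := fP j (ltn_ord j) Tj; rewrite (TP j (ltn_ord j)) in Tj.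
  by congr (nat_of_bool _); apply/eqP/eqP => E; move: Pi; rewrite -E ?Tj ?Pf.
(* For [d <= lo] a task of [T] follows [f] as soon as one of its two hosts lies in [B], so the loads
   on [B] become those of [f]. *)
pose b' j := if T j && (B (f j) || B (b j)) then f j else b j.
have lb' : legal b'.
  move=> j jn; rewrite /b'; case: ifP => [/andP[Tj _]|_]; last exact: lb.
  by case: (fP j jn Tj).
exists b'; split=> //.
- by move=> j jn /negbTE Tj; rewrite /b' Tj.
- move=> j jn Tj; rewrite /b' Tj /=; have [_ Pf _] := fP j jn Tj.
  case: ifP => [//|/norP[nf nb]]; split; first by rewrite -TP.
  by apply/eqP/eqP => E; move: nf nb; rewrite E Bp.
(* [x] marks the tasks evicted from [B]: each adds at most one to the excess outside [B] and, by
   [s5], takes one task off [B]. *)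
pose x j := [&& T j, ~~ B (f j) & B (b j)].
have Peq (F : 'I_m -> nat) : \sum_(i < m) F i =
    \sum_(i < m | ~~ P i) F i + \sum_(i < m | P i && ~~ B i) F i +
    \sum_(i < m | B i) F i.
  rewrite (bigID (fun i : 'I_m => P i)) /= addnC -addnA; congr (_ + _).
  rewrite (bigID (fun i : 'I_m => B i)) /= addnC; congr (_ + _).
  apply: eq_bigl => i; apply/andP/idP => [[]//|Bi].
  by split=> //; apply: BP.
rewrite /excess !Peq.
have s1 : \sum_(i < m | ~~ P i) (cnt b' i - d) = \sum_(i < m | ~~ P i) (cnt b i - d).
  apply: eq_bigr => i nP; congr (_ - _); apply: eq_bigr => j _.
  rewrite /b'; case: ifP => [/andP[Tj _]|//].
  have [_ Pf _] := fP j (ltn_ord j) Tj; rewrite (TP j (ltn_ord j)) in Tj.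
  by congr (nat_of_bool _); apply/eqP/eqP => E; move: nP; rewrite -E ?Tj ?Pf.
have s2 : \sum_(i < m | P i && ~~ B i) (cnt b' i - d) <=
    \sum_(i < m | P i && ~~ B i) (cnt b i - d) + \sum_(j < n) x j.
  pose f' j := if x j then f j else m.
  have : \sum_(i < m | P i && ~~ B i) cnt f' i <= \sum_(j < n) x j.
    rewrite (sum_fibre (fun i => P i && ~~ B i)); apply: leq_sum => j _.
    by rewrite /f'; case: (x j); rewrite ?ltnn //=; case: (_ && _).
  suff : \sum_(i < m | P i && ~~ B i) (cnt b' i - d) <=
      \sum_(i < m | P i && ~~ B i) ((cnt b i - d) + cnt f' i).
    by rewrite big_split /=; lia.
  apply: leq_sum => i /andP[Pi nB].
  suff : cnt b' i <= cnt b i + cnt f' i by lia.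
  rewrite -big_split; apply: leq_sum => j _ /=; rewrite /b' /f' /x.
  case: (T j) => //=; last by lia.
  case Bf: (B (f j)) => /=.
    by case: eqP => // E; move: nB; rewrite -E Bf.
  by case: (B (b j)); lia.
have cb' (i : 'I_m) : B i -> cnt b' i = cnt f i.
  move=> Bi; apply: eq_bigr => j _; rewrite /b'.
  case: ifP => [//|H]; congr (nat_of_bool _).
  have Pi := BP i (ltn_ord i) Bi.
  apply/eqP/eqP => E.
    by move: H; rewrite (TP j (ltn_ord j)) E Pi Bi orbT.
  move: H; rewrite E Bi andbT => /negbT /(fN j (ltn_ord j)) E'.
  by have := ltn_ord i; lia.
(* On [B] the new loads are at least [lo >= d], so the truncated subtraction is exact there; for [b]
   only an upper bound on the loads results, which is the right direction. *)
have s3 : \sum_(i < m | B i) (cnt b' i - d) + \sum_(i < m | B i) d =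
    \sum_(i < m | B i) cnt b' i.
  rewrite -big_split /=; apply: eq_bigr => i Bi.
  by rewrite subnK // cb' //; apply: leq_trans (Blo i (ltn_ord i) Bi).
have s4 : \sum_(i < m | B i) cnt b i <=
    \sum_(i < m | B i) (cnt b i - d) + \sum_(i < m | B i) d.
  by rewrite -big_split /=; apply: leq_sum => i Bi; lia.
have s5 : \sum_(i < m | B i) cnt b' i + \sum_(j < n) x j <= \sum_(i < m | B i) cnt b i.
  rewrite !sum_fibre -big_split; apply: leq_sum => j _ /=.
  have jn := ltn_ord j; have [bm be] := lb j jn; have [b'm _] := lb' j jn.
  rewrite bm b'm /= /x /b'; case Tj: (T j) => /=; last by lia.
  have Pb : P (b j) by rewrite -TP.
  (* By closure no task enters [B]: if [f] places it in [B], so did [b]. *)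
  case Bf: (B (f j)) => /=; first by rewrite Bf (Bcl _ j bm jn Tj Pb be Bf).
  by case Bb: (B (b j)); rewrite ?Bf ?Bb.
lia.
Qed.

End Assignments.

(** * Breadth-first search *)

Section Search.
Local Open Scope nat_scope.
Variables (m n : nat) (el : nat -> nat -> bool).
Variables (P T : pred nat) (c : nat).

Definition upd (f : nat -> nat) k v := fun l => if l == k then v else f l.

(* Processors below M have been entered; the rank in the queue certifies that
   following tf and fr leads back to the source. *)
Record searched f M (ps ts fr tf qu : nat -> nat) qt : Prop := Searched {
  searched_queue : forall q, q < qt ->
    [/\ qu q < M, ps (qu q) != 0, P (qu q) &
      fr (qu q) = n /\ cnt n f (qu q) < c \/
      [/\ fr (qu q) < n, ts (fr (qu q)) != 0, f (fr (qu q)) = qu q &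
          exists2 q', q' < q & tf (fr (qu q)) = qu q']];
  searched_inj : forall q q', q < qt -> q' < qt -> qu q = qu q' -> q = q';
  searched_proc : forall i, i < M -> ps i != 0 -> exists2 q, q < qt & qu q = i;
  searched_task : forall j, j < n -> ts j != 0 ->
    [/\ T j, el (tf j) j & exists2 q, q < qt & tf j = qu q];
  searched_source : forall i, i < M -> P i -> cnt n f i < c -> ps i != 0 }.

Lemma searched_init f ps ts fr tf qu : (forall j, j < n -> ts j = 0) ->
  searched f 0 ps ts fr tf qu 0.
Proof. by move=> ts0; split=> // j jn; rewrite ts0. Qed.

Lemma searched_skip f M ps ts fr tf qu qt :
  searched f M ps ts fr tf qu qt -> ~~ (P M && (cnt n f M < c)) ->
  searched f M.+1 (upd ps M 0) ts fr tf qu qt.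
Proof.
move=> [S1 S2 S3 S4 S5] nM; rewrite /upd; split=> //.
- move=> q qqt; case: (S1 q qqt) => a b d e; split=> //; first exact: ltnW.
  by case: (qu q =P M) => // E; rewrite E ltnn in a.
- move=> i iM; case: (i =P M) => // ne; apply: S3; lia.
- move=> i iM Pi ci; case: (i =P M) => E; first by rewrite -E Pi ci in nM.
  by apply: S5 => //; lia.
Qed.

Lemma searched_push_source f M ps ts fr tf qu qt :
  searched f M ps ts fr tf qu qt -> P M -> cnt n f M < c ->
  searched f M.+1 (upd (upd ps M 0) M 1) ts (upd fr M n) tf (upd qu qt M)
    (qt + 1).
Proof.
move=> [S1 S2 S3 S4 S5] PM cM; rewrite /upd; split=> //.
- move=> q qqt; case: (q =P qt) => E; first by rewrite eqxx; split=> //; left.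
  have qqt' : q < qt by lia.
  case: (S1 q qqt') => a b d e; have -> : qu q == M = false by lia.
  split=> //; first lia.
  case: e => [?|[? ? ? [q' lt e]]]; [by left|right; split=> //].
  by exists q' => //; have -> : q' == qt = false by lia.
- move=> q q' qqt qqt'; case: (q =P qt) => E1; case: (q' =P qt) => E2; first lia.
  + by move=> E; have [] := S1 q' ltac:(lia); rewrite -E ltnn.
  + by move=> E; have [] := S1 q ltac:(lia); rewrite E ltnn.
  + by apply: S2; lia.
- move=> i iM; case: (i =P M) => [->|ne] pi; first by exists qt; [lia|rewrite eqxx].
  have [|q lt E] := S3 i _ pi; first lia.
  by exists q; [lia|have -> : q == qt = false by lia].
- move=> j jn tj; have [a b [q lt e]] := S4 j jn tj; split=> //.
  by exists q; [lia|have -> : q == qt = false by lia].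
- move=> i iM Pi ci; case: (i =P M) => // E.
  by apply: S5 => //; lia.
Qed.

(** No queued processor has an unseen task as its [fr] entry, so overwriting [tf j] leaves all
    recorded back paths intact. *)
Lemma searched_reach_task f ps ts fr tf qu qt q j :
  searched f m ps ts fr tf qu qt -> q < qt -> j < n -> T j -> el (qu q) j ->
  ts j = 0 ->
  searched f m ps (upd ts j 1) fr (upd tf j (qu q)) qu qt.
Proof.
move=> [S1 S2 S3 S4 S5] qqt jn Tj e tj; rewrite /upd; split=> //.
- move=> q1 q1t; case: (S1 q1 q1t) => a b d h; split=> //.
  case: h => [|[? ne ? ?]]; [by left|right].
  by have -> : fr (qu q1) == j = false by apply/eqP => E; rewrite E tj in ne.
- move=> j' j'n; case: (j' =P j) => [-> _|_ t']; last exact: S4.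
  by split=> //; exists q.
Qed.

Lemma searched_push_task f ps ts fr tf qu qt j :
  searched f m ps ts fr tf qu qt -> j < n -> ts j != 0 -> f j < m ->
  P (f j) -> ps (f j) = 0 ->
  searched f m (upd ps (f j) 1) ts (upd fr (f j) j) tf (upd qu qt (f j))
    (qt + 1).
Proof.
move=> [S1 S2 S3 S4 S5] jn tj fm Pf pf; rewrite /upd.
have fresh q : q < qt -> qu q == f j = false.
  by move=> qqt; apply/eqP => E; case: (S1 q qqt) => _; rewrite E pf.
split=> //.
- move=> q qqt; case: (q =P qt) => E.
    rewrite eqxx; split=> //; right; split=> //.
    have [_ _ [q' lt' e']] := S4 j jn tj.
    by exists q'; [lia|have -> : q' == qt = false by lia].
  have qqt' : q < qt by lia.
  case: (S1 q qqt') => a b d e; rewrite fresh //; split=> //.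
  case: e => [?|[? ? ? [q' lt e]]]; [by left|right; split=> //].
  by exists q' => //; have -> : q' == qt = false by lia.
- move=> q q' qqt qqt'; case: (q =P qt) => E1; case: (q' =P qt) => E2; first lia.
  + by move=> E; have := fresh q' ltac:(lia); rewrite E eqxx.
  + by move=> E; have := fresh q ltac:(lia); rewrite E eqxx.
  + by apply: S2; lia.
- move=> i iM; case: (i =P f j) => [->|ne] pi; first by exists qt; [lia|rewrite eqxx].
  have [q lt E] := S3 i iM pi.
  by exists q; [lia|have -> : q == qt = false by lia].
- move=> j' j'n tj'; have [a b [q lt e]] := S4 j' j'n tj'; split=> //.
  by exists q; [lia|have -> : q == qt = false by lia].
- move=> i iM Pi ci; case: (i =P f j) => // E.
  exact: S5.
Qed.

(** Pigeonhole: the queue holds distinct processors. This bounds the number of visits. *)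
Lemma searched_size f ps ts fr tf qu qt :
  searched f m ps ts fr tf qu qt -> qt <= m.
Proof.
move=> S; pose s := [seq qu q | q <- iota 0 qt].
have -> : qt = size s by rewrite size_map size_iota.
rewrite -(size_iota 0 m); apply: uniq_leq_size.
  rewrite map_inj_in_uniq ?iota_uniq // => q q'; rewrite !mem_iota /= !add0n.
  by move=> lt lt'; apply: (searched_inj S).
move=> i /mapP[q]; rewrite !mem_iota /= !add0n => lt ->.
by case: (searched_queue S lt).
Qed.

(** The case [f j = i] is exempt because the arc from [i] to [j] then already carries its unit and
    is not residual. *)
Definition scanned f (ts : nat -> nat) i k :=
  forall j, j < k -> T j -> el i j -> f j = i \/ ts j != 0.

(** When the queue is exhausted without reaching the sink, the entered processors are closed under
    residual arcs: a task hosted by an entered [i] leads back to [i], a seen one to its entered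
    host. *)
Lemma searched_cut f ps ts fr tf qu qt :
  searched f m ps ts fr tf qu qt ->
  (forall q, q < qt -> scanned f ts (qu q) n) ->
  (forall j, j < n -> ts j != 0 -> f j < m /\ ps (f j) != 0) ->
  source_cut m n el P T c f (fun i => (i < m) && (ps i != 0)).
Proof.
move=> S sc ft; split.
- by move=> i im Pi ci; rewrite im (searched_source S).
- move=> i im /andP[_ pi]; have [q lt <-] := searched_proc S im pi.
  by case: (searched_queue S lt).
- move=> i j im jn /andP[_ pi] Tj e; have [q lt E] := searched_proc S im pi.
  rewrite -E in e; case: (sc q lt j jn Tj e) => [->|/(ft j jn)[-> ->]] //.
  by rewrite E im pi.
Qed.

(* f is the flow g after rerouting part of the path; the processor in queue
   position q carries one task too many, which the rest of the path takes over. *)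
Record rerouting g f (fr tf qu : nat -> nat) q : Prop := Rerouting {
  rerouting_flow : flow m n el P T f;
  rerouting_cnt : forall i, i < m -> cnt n f i = cnt n g i + (i == qu q);
  rerouting_path : forall q', q' <= q -> fr (qu q') < n ->
     f (fr (qu q')) = qu q';
  rerouting_sum : \sum_(j < n) (f j < m) = (\sum_(j < n) (g j < m)).+1 }.

(** A balance of sums avoids truncated subtraction. *)
Lemma cnt_upd f j k i : j < n ->
  cnt n (upd f j k) i + (f j == i) = cnt n f i + (k == i).
Proof.
move=> jn; rewrite /cnt (bigD1 (Ordinal jn)) //= [in RHS](bigD1 (Ordinal jn)) //=.
rewrite /upd eqxx; set X := \sum_(_ < _ | _) _; set Y := \sum_(_ < _ | _) _.
suff -> : X = Y by rewrite addnAC [RHS]addnAC; congr (_ + _); rewrite addnC.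
apply: eq_bigr => l /eqP ne; case: (nat_of_ord l =P j) => // E.
by case: ne; apply: val_inj.
Qed.

Lemma assigned_upd f j k : j < n -> k < m ->
  \sum_(l < n) (upd f j k l < m) + (f j < m) = (\sum_(l < n) (f l < m)).+1.
Proof.
move=> jn km; rewrite (bigD1 (Ordinal jn)) //= [in RHS](bigD1 (Ordinal jn)) //=.
rewrite /upd eqxx km; set X := \sum_(_ < _ | _) _; set Y := \sum_(_ < _ | _) _.
suff -> : X = Y by rewrite add1n addSn addnC.
apply: eq_bigr => l /eqP ne; case: (nat_of_ord l =P j) => // E.
by case: ne; apply: val_inj.
Qed.

Lemma flow_upd f j k : flow m n el P T f -> k < m -> P k -> T j -> el k j ->
  flow m n el P T (upd f j k).
Proof.
move=> ff km Pk Tj e l ln; rewrite /upd; case: eqP => [->|_]; last exact: ff.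
by right.
Qed.

Lemma rerouting_start f ps ts fr tf qu qt j :
  flow m n el P T f ->
  searched f m ps ts fr tf qu qt -> j < n -> ts j != 0 -> f j = m ->
  exists q, [/\ q < qt, tf j = qu q & rerouting f (upd f j (tf j)) fr tf qu q].
Proof.
move=> ff S jn tj fj; have [Tj e [q lt E]] := searched_task S jn tj.
have [qm _ Pq _] := searched_queue S lt.
exists q; split=> //; rewrite E in e *; split.
- exact: flow_upd.
- move=> i im; have := cnt_upd f (qu q) i jn; rewrite fj.
  have -> : m == i = false by lia.
  by rewrite eq_sym; lia.
(* The newly assigned task was free under [f], whereas the tasks on back paths are all assigned, so
   it is none of them. *)
- move=> q' le fn; rewrite /upd; case: eqP => E'.
    have [] := searched_queue S (leq_ltn_trans le lt).
    move=> h _ _ [[E2 _]|[_ _ h' _]]; first lia.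
    by move: h'; rewrite E' fj; lia.
  have [] := searched_queue S (leq_ltn_trans le lt).
  by move=> _ _ _ [[E2 _]|[]//]; lia.
- have := assigned_upd f jn qm; rewrite fj; lia.
Qed.

Lemma rerouting_next g f ps ts fr tf qu qt q :
  searched g m ps ts fr tf qu qt -> q < qt ->
  rerouting g f fr tf qu q -> fr (qu q) < n ->
  exists q', [/\ q' < q, tf (fr (qu q)) = qu q' &
    rerouting g (upd f (fr (qu q)) (tf (fr (qu q)))) fr tf qu q'].
Proof.
move=> S lt [F1 F2 F3 F4] fn.
have [qm _ Pq] := searched_queue S lt.
case=> [[E _]|[_ tj gj [q' lt' E]]]; first lia.
have lt'' : q' < qt by lia.
have [q'm _ Pq' _] := searched_queue S lt''.
have [Tj e _] := searched_task S fn tj.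
have fj := F3 q (leqnn q) fn.
exists q'; split=> //; rewrite E in e *; split.
- exact: flow_upd.
- move=> i im; have := cnt_upd f (qu q') i fn; rewrite fj F2 //.
  by rewrite [qu q == _]eq_sym [qu q' == _]eq_sym; lia.
(* If the moved task were also the [fr] entry of an earlier position, both positions would hold its
   host, against the injectivity of the queue. *)
- move=> q1 le1 fn1; rewrite /upd; case: eqP => E'; last by apply: F3; lia.
  have := F3 q1 ltac:(lia) fn1; rewrite E' fj => Eq.
  by have := searched_inj S lt (leq_ltn_trans le1 lt'') Eq; lia.
- have := assigned_upd f fn q'm; rewrite fj qm; lia.
Qed.

End Search.

(** * Timed program logic *)

Section Logic.
Local Open Scope nat_scope.
Context {R : realType}.
Implicit Types (s : state R) (Q : state R -> Prop) (c : cmd).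

Definition runs c s T Q :=
  exists t s', [/\ exec c s t s', t <= T & Q s'].

Fixpoint nwrites (y : string) c : bool :=
  match c with
  | Skip | RPut _ _ _ => false
  | Put x _ _ => String.eqb y x
  | Seq c1 c2 | If _ c1 c2 => nwrites y c1 || nwrites y c2
  | While _ c1 => nwrites y c1
  end.

Fixpoint rwrites (y : string) c : bool :=
  match c with
  | Skip | Put _ _ _ => false
  | RPut x _ _ => String.eqb y x
  | Seq c1 c2 | If _ c1 c2 => rwrites y c1 || rwrites y c2
  | While _ c1 => rwrites y c1
  end.

(** Writes are tracked syntactically, per array name; untouched arrays thus pass through loops
    without being mentioned in the invariants. *)
Definition frame c s s' :=
  (forall y, ~~ nwrites y c -> nmem s' y = nmem s y) /\
  (forall y, ~~ rwrites y c -> rmem s' y = rmem s y).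

Lemma exec_frame c s t s' : exec c s t s' -> frame c s s'.
Proof.
elim=> {c s t s'}.
- by [].
- move=> x e1 e2 s; split=> //= y /negbTE E.
  by rewrite /update E.
- move=> x e1 e2 s; split=> //= y /negbTE E.
  by rewrite /update E.
- move=> c1 c2 s t1 s1 t2 s2 _ [F1 G1] _ [F2 G2].
  by split=> y /= /norP[H1 H2]; rewrite ?F2 ?F1 ?G2 ?G1.
- move=> e c1 c2 s t s' _ _ [F G].
  by split=> y /= /norP[H1 H2]; rewrite ?F ?G.
- move=> e c1 c2 s t s' _ _ [F G].
  by split=> y /= /norP[H1 H2]; rewrite ?F ?G.
- move=> e c s t1 s1 t2 s2 _ _ [F1 G1] _ [F2 G2].
  by split=> y H; rewrite ?F2 ?F1 ?G2 ?G1.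
- by [].
Qed.

Fixpoint loopfree c : bool :=
  match c with
  | Skip | Put _ _ _ | RPut _ _ _ => true
  | Seq c1 c2 | If _ c1 c2 => loopfree c1 && loopfree c2
  | While _ _ => false
  end.

(** Meaningful only under [loopfree]: the value at [While] is a dummy. *)
Fixpoint step c s : state R :=
  match c with
  | Put x e1 e2 => nput s x (eval s e1) (eval s e2)
  | RPut x e1 e2 => rput s x (eval s e1) (reval s e2)
  | Seq c1 c2 => step c2 (step c1 s)
  | If e c1 c2 => if eval s e != 0 then step c1 s else step c2 s
  | Skip | While _ _ => s
  end.

Fixpoint steps c : nat :=
  match c with
  | Skip | While _ _ => 1
  | Put _ e1 e2 => (cost e1 + cost e2).+1
  | RPut _ e1 e2 => (cost e1 + rcost e2).+1
  | Seq c1 c2 => steps c1 + steps c2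
  | If e c1 c2 => (cost e + maxn (steps c1) (steps c2)).+1
  end.

Lemma exec_step c s : loopfree c ->
  exists2 t, exec c s t (step c s) & t <= steps c.
Proof.
elim: c s => [|x e1 e2|x e1 e2|c1 IH1 c2 IH2|e c1 IH1 c2 IH2|//] s /=.
- by exists 1 => //; constructor.
- by eexists; first constructor.
- by eexists; first constructor.
- case/andP=> l1 l2; have [t1 E1 le1] := IH1 s l1.
  have [t2 E2 le2] := IH2 (step c1 s) l2.
  by eexists; [econstructor; eassumption|exact: leq_add].
- case/andP=> l1 l2; case: ifP => [ne|/negbT/negPn/eqP E0].
    have [t1 E1 le1] := IH1 s l1.
    by exists (cost e + t1).+1; [apply: exec_if_true|lia].
  have [t2 E2 le2] := IH2 s l2.
  by exists (cost e + t2).+1; [apply: exec_if_false|lia].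
Qed.

Lemma runs_step c s T Q : loopfree c -> steps c <= T -> Q (step c s) ->
  runs c s T Q.
Proof.
move=> l le q; have [t E le'] := exec_step s l.
by exists t, (step c s); split=> //; lia.
Qed.

Lemma runs_weaken c s T T' Q Q' : runs c s T Q -> T <= T' ->
  (forall s', Q s' -> frame c s s' -> Q' s') -> runs c s T' Q'.
Proof.
move=> [t [s' [E le q]]] le' W; exists t, s'; split=> //; first lia.
by apply: W q _; apply: exec_frame E.
Qed.

Lemma runs_seq c1 c2 s T1 T2 T Q1 Q : runs c1 s T1 Q1 ->
  (forall s1, Q1 s1 -> frame c1 s s1 -> runs c2 s1 T2 Q) ->
  T1 + T2 <= T -> runs (Seq c1 c2) s T Q.
Proof.
move=> [t1 [s1 [E1 le1 q1]]] H le.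
have [t2 [s2 [E2 le2 q2]]] := H s1 q1 (exec_frame E1).
by exists (t1 + t2), s2; split=> //; [econstructor; eassumption|lia].
Qed.

Lemma runs_if e c1 c2 s T T' Q :
  (eval s e != 0 -> runs c1 s T Q) -> (eval s e = 0 -> runs c2 s T Q) ->
  (cost e + T).+1 <= T' -> runs (If e c1 c2) s T' Q.
Proof.
move=> H1 H2 le; case: (eqVneq (eval s e) 0) => [E0|ne].
  have [t [s' [E le' q]]] := H2 E0.
  by exists (cost e + t).+1, s'; split=> //; [apply: exec_if_false|lia].
have [t [s' [E le' q]]] := H1 ne.
by exists (cost e + t).+1, s'; split=> //; [apply: exec_if_true|lia].
Qed.

(** The index of the invariant is a variant: it falls with every iteration and so bounds their
    number, which gives termination and the time bound together. *)
Lemma runs_while e c (Inv : nat -> state R -> Prop) Tb k s T :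
  Inv k s ->
  (forall k s', frame c s s' -> Inv k s' -> eval s' e != 0 ->
     runs c s' Tb (fun s'' => exists2 k', k' < k & Inv k' s'')) ->
  k * (cost e + Tb).+1 + (cost e).+1 <= T ->
  runs (While e c) s T
    (fun s' => [/\ exists k, Inv k s', eval s' e = 0 & frame c s s']).
Proof.
move=> I0 body le.
suff H k0 s0 : Inv k0 s0 -> frame c s s0 ->
    runs (While e c) s0 (k0 * (cost e + Tb).+1 + (cost e).+1)
      (fun s' => [/\ exists k, Inv k s', eval s' e = 0 & frame c s s']).
  have [//|t [s' [E le' q]]] := H k s I0.
  by exists t, s'; split=> //; apply: leq_trans le.
have [N leN] := ubnP k0.
elim: N k0 s0 leN {I0 le k} => // N IH k s0 leN I0 F0.
case: (eqVneq (eval s0 e) 0) => [E0|ne].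
  exists (cost e).+1, s0; split; [exact: exec_while_false|exact: leq_addl|].
  by split=> //; exists k.
have [t1 [s1 [E1 le1 [k' lt I1]]]] := body k s0 F0 I0 ne.
have F1 : frame c s s1.
  have [Fa Ga] := exec_frame E1; case: F0 => [Fb Gb].
  by split=> y H; rewrite ?Fa ?Fb ?Ga ?Gb.
have [t2 [s2 [E2 le2 q2]]] := IH k' s1 ltac:(lia) I1 F1.
exists (cost e + t1 + t2).+1, s2; split=> //.
  exact: exec_while_true E1 E2.
have : k'.+1 * (cost e + Tb).+1 <= k * (cost e + Tb).+1 by rewrite leq_mul2r lt orbT.
by rewrite mulSn; lia.
Qed.

(** The bound [e] is evaluated anew at every iteration, so it has to keep the value [N] on all
    states allowed by the frame and the invariant. *)
Lemma runs_for x e c N (Inv : nat -> state R -> Prop) Tb s T :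
  ~~ nwrites x c ->
  Inv 0 (nput s x 0 0) ->
  (forall i s', frame (For x e c) s s' -> Inv i s' -> eval s' e = N) ->
  (forall i s', i < N -> frame (For x e c) s s' -> Inv i s' -> nmem s' x 0 = i ->
     runs c s' Tb (fun s'' => Inv i.+1 (nput s'' x 0 i.+1))) ->
  N * (cost e + Tb + 10) + cost e + 10 <= T ->
  runs (For x e c) s T (fun s' => Inv N s').
Proof.
move=> nx I0 eN body le.
apply: (@runs_seq _ _ _ 3 _ _ (fun s1 => s1 = nput s x 0 0)) => //.
- exact: runs_step.
- move=> s1 -> F1.
  apply: runs_weaken; first apply: (@runs_while _ _
    (fun k s' => exists i, [/\ i + k = N, Inv i s' & nmem s' x 0 = i])
    (Tb + 6) N).
  + by exists 0; rewrite add0n /= /update String.eqb_refl eqxx.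
  + move=> k s' F2 [i [ik Ii xi]]; rewrite /= xi.
    have F3 : frame (For x e c) s s'.
      case: F2 => Fa Ga; split=> y /= H; last by rewrite Ga.
      case/norP: H => H1 H2; rewrite Fa //=.
      by rewrite /update (negbTE H1).
    have iN : eval s' e = N by apply: eN Ii.
    rewrite iN eqb0 negbK => lt.
    apply: (runs_seq (T2 := 6)); first by apply: body Ii xi.
      move=> s1' I1 F4; apply: runs_step => //=.
      exists k.-1; first lia.
      case: F4 => F4 _; rewrite F4 // xi addn1.
      exists i.+1; split=> //; first lia.
      by rewrite /update String.eqb_refl eqxx.
    by lia.
  + exact: leqnn.
  + exact: leqnn.
  + move=> s' [[k [i [ik Ii xi]]] /= ev F2] _; move: ev; rewrite xi.
    have F3 : frame (For x e c) s s'.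
      case: F2 => Fa Ga; split=> y /= H; last by rewrite Ga.
      case/norP: H => H1 H2; rewrite Fa //=.
      by rewrite /update (negbTE H1).
    rewrite (eN _ _ F3 Ii) => /eqP; rewrite eqb0 -leqNgt => ge.
    by have <- : i = N by lia.
- move: le; have -> : N * (cost e + Tb + 10) = N * (2 + cost e).+1.+1 + N * (Tb + 6).
    by rewrite -mulnDr; congr muln; lia.
  rewrite /=; have -> : N * (2 + cost e + (Tb + 6)).+2 = N * (2 + cost e).+1.+1 + N * (Tb + 6).
    by rewrite -mulnDr; congr muln; lia.
  by lia.
Qed.

End Logic.

Lemma runs_step_seq {R : realType} c1 c2 (s : state R) T1 T2 T Q : loopfree c1 ->
  runs c2 (step c1 s) T2 Q -> steps c1 <= T1 -> T1 + T2 <= T ->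
  runs (Seq c1 c2) s T Q.
Proof.
move=> l H le1 le; apply: (runs_seq (T1 := T1) (Q1 := fun s1 => s1 = step c1 s)) le.
  exact: runs_step.
by move=> s1 ->.
Qed.

Lemma nat_of_bool_neq0 (b : bool) : (b != 0%N :> nat) = b.
Proof. by case: b. Qed.

Section Step.
Local Open Scope nat_scope.
Context {R : realType}.
Implicit Types s : state R.

Lemma step_skip s : step Skip s = s. Proof. by []. Qed.

Lemma step_put s x e1 e2 :
  step (Put x e1 e2) s = nput s x (eval s e1) (eval s e2).
Proof. by []. Qed.

Lemma step_rput s x e1 e2 :
  step (RPut x e1 e2) s = rput s x (eval s e1) (reval s e2).
Proof. by []. Qed.

Lemma step_seq s c1 c2 : step (Seq c1 c2) s = step c2 (step c1 s).
Proof. by []. Qed.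

Lemma step_if s e c1 c2 :
  step (If e c1 c2) s = if eval s e != 0 then step c1 s else step c2 s.
Proof. by []. Qed.

Lemma step_frame c s : loopfree c -> frame c s (step c s).
Proof. by case/(exec_step s) => t /exec_frame. Qed.

End Step.

#[local] Arguments step : simpl never.
#[local] Arguments update {T} f x k v y / l.

Ltac put := rewrite ?step_seq ?step_put /=.

(** * The algorithm *)

Section Flow.
Local Open Scope nat_scope.
Local Open Scope string_scope.
Context {R : realType}.
Variables (m n : nat) (el : nat -> nat -> bool).
Implicit Types s : state R.

Record env s pd td : Prop := Env {
  env_m : nmem s "m" 0 = m;
  env_n : nmem s "n" 0 = n;
  env_elig : forall i j, i < m -> j < n ->
    nmem s "elig" (i * n + j) = nat_of_bool (el i j);
  env_pdone : nmem s "pdone" = pd;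
  env_tdone : nmem s "tdone" = td }.

Definition kept c := ~~ (nwrites "m" c || nwrites "n" c || nwrites "elig" c ||
  nwrites "pdone" c || nwrites "tdone" c).

Lemma env_frame c s s' pd td : frame c s s' -> kept c ->
  env s pd td -> env s' pd td.
Proof.
move=> [F _]; rewrite /kept !negb_or => /andP[/andP[/andP[/andP[w1 w2] w3] w4] w5].
by move=> [E1 E2 E3 E4 E5]; split; rewrite F.
Qed.

Record flow_env s pd td f c : Prop := FlowEnv {
  flow_env_env :> env s pd td;
  flow_env_asg : nmem s "asg" = f;
  flow_env_load : forall i, i < m -> nmem s "load" i = cnt n f i;
  flow_env_c : nmem s "c" 0 = c }.

Lemma flow_env_frame c' s s' pd td f c : frame c' s s' -> kept c' ->
  ~~ (nwrites "asg" c' || nwrites "load" c' || nwrites "c" c') ->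
  flow_env s pd td f c -> flow_env s' pd td f c.
Proof.
move=> F k; have [F' _] := F; rewrite !negb_or => /andP[/andP[w1 w2] w3] [E1 E2 E3 E4].
split; rewrite ?F' //; exact: (env_frame F k E1).
Qed.

Definition live (d : nat -> nat) : pred nat := fun i => d i == 0.

(** The loop bodies of [find_augmenting_path] get names, so that each loop can be given its own
    invariant. *)
Definition search_scan : cmd :=
  (If (("elig"#("i" * "n" + "j") == 1) && ("tdone"#"j" == 0) &&
      ("tseen"#"j" == 0) && (("asg"#"j" == "i") == 0)) (
    "tseen"##"j" <~ 1 ;; "tfrom"##"j" <~ "i" ;;
    "k" <~ "asg"#"j" ;;
    If ("k" == "m") ("found" <~ 1 ;; "last" <~ "j") (
      If ("pseen"#"k" == 0) (
        "pseen"##"k" <~ 1 ;; "from"##"k" <~ "j" ;;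
        "queue"##"qtail" <~ "k" ;; "qtail" <~ "qtail" + 1)
      Skip))
  Skip ;;
  "j" <~ "j" + 1)%imp.

Definition search_init : cmd :=
  ("pseen"##"i" <~ 0 ;;
  If (("pdone"#"i" == 0) && ("load"#"i" < "c")) (
    "pseen"##"i" <~ 1 ;; "from"##"i" <~ "n" ;;
    "queue"##"qtail" <~ "i" ;; "qtail" <~ "qtail" + 1)
  Skip)%imp.

Definition search_visit : cmd :=
  ("i" <~ "queue"#"qhead" ;; "qhead" <~ "qhead" + 1 ;;
  "j" <~ 0 ;;
  While (("found" == 0) && ("j" < "n")) search_scan)%imp.

Lemma find_augmenting_pathE : find_augmenting_path =
  ("found" <~ 0 ;; "qhead" <~ 0 ;; "qtail" <~ 0 ;;
  For "j" "n" ("tseen"##"j" <~ 0) ;;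
  For "i" "m" search_init ;;
  While (("found" == 0) && ("qhead" < "qtail")) search_visit)%imp.
Proof. by []. Qed.

(** * Search and augmentation for a fixed flow *)

Section Search.
Variables (pd td f : nat -> nat) (c : nat).
Hypothesis ff : flow m n el (live pd) (live td) f.

Definition found_path s :=
  [/\ nmem s "last" 0 < n, nmem s "tseen" (nmem s "last" 0) != 0
    & f (nmem s "last" 0) = m].

Definition reached s M :=
  searched n el (live pd) (live td) c f M (nmem s "pseen") (nmem s "tseen")
    (nmem s "from") (nmem s "tfrom") (nmem s "queue") (nmem s "qtail" 0).

Definition seen_closed s := forall j, j < n -> nmem s "tseen" j != 0 ->
  f j < m /\ nmem s "pseen" (f j) != 0.

(** Invariant for scanning the processor at queue position [h], the tasks below [j] being done. Once
    the sink is reached only the back pointers matter, so the clauses that lead to a cut are asked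
    only while [found] is 0. *)
Record visiting (s : state R) h i j : Prop := Visiting {
  visiting_queue : nmem s "queue" h = i;
  visiting_reached : reached s m;
  visiting_head : h < nmem s "qtail" 0;
  visiting_found : nmem s "found" 0 != 0 -> found_path s;
  visiting_scanned : nmem s "found" 0 = 0 -> 
    [/\ forall q, q < h -> scanned el (live td) f (nmem s "tseen") (nmem s "queue" q) n,
       scanned el (live td) f (nmem s "tseen") i j
     & seen_closed s] }.

Lemma visiting_j s h i j v :
  visiting s h i j -> visiting (nput s "j" 0 v) h i j.
Proof. by case. Qed.

Lemma step_scan s h i j : flow_env s pd td f c -> visiting s h i j -> j < n ->
  nmem s "found" 0 = 0 -> nmem s "i" 0 = i -> nmem s "j" 0 = j ->
  visiting (step search_scan s) h i j.+1.
Proof.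
move=> [[Em En Ee Ep Et] Ea El Ec] [hi S hq fo sc] jn f0 ih jj.
have [sc1 sc2 sc3] := sc f0.
have [im pi Pi _] := searched_queue S hq; rewrite hi in im pi Pi.
rewrite /search_scan step_seq step_put; apply: visiting_j.
rewrite step_if /= !nat_of_bool_neq0 En ih jj Ee // Ea Et eqb0.
(* A live eligible task that the test rejects is either hosted by [i] or already seen, exactly as
   [scanned] asks. *)
case: ifP => [/andP[/andP[/andP[e Tj] sj] aj]|H]; last first.
  rewrite step_skip.
  split=> //= _; split=> // j'; rewrite ltnS leq_eqVlt => /orP[/eqP->|lt]; last exact: sc2.
  move=> Tj e; move: H; rewrite e /= [_ == _]Tj /=.
  by case: (nmem s "tseen" j =P 0) => //= ne; [move/negPn/eqP; left|move=> _; right; apply/eqP].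
rewrite eqb1 in e; move/eqP: (sj) => sj0.
rewrite -hi in e; have S1 := searched_reach_task S hq jn Tj e sj0; rewrite hi in S1 e.
have scm i1 k : scanned el (live td) f (nmem s "tseen") i1 k ->
    scanned el (live td) f (upd (nmem s "tseen") j 1) i1 k.
  move=> H j' lt T' e'; case: (H j' lt T' e'); [by left|right].
  by rewrite /upd; case: (j' =P j).
have sc2' : scanned el (live td) f (upd (nmem s "tseen") j 1) i j.+1.
  move=> j'; rewrite ltnS leq_eqVlt => /orP[/eqP->|lt]; last by apply: (scm _ _ sc2).
  by move=> _ _; right; rewrite /upd eqxx.
put; rewrite step_if /= jj Ea Em ih.
(* Three outcomes for the new task: it is free and the sink is reached; its host was entered before;
   or its host is appended to the queue. *)
rewrite nat_of_bool_neq0; case: eqP => [fm|nfm].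
  put; split=> //=; rewrite ?jj //.
  by split; rewrite //= ?jj ?eqxx.
have [//|[fm Pf _ _]] := ff jn.
rewrite step_if /= nat_of_bool_neq0; case: eqP => [pf|npf]; last first.
  rewrite step_skip; split=> //=; first by rewrite f0.
  move=> _; split=> //=.
    by move=> q lt; apply: scm; apply: sc1.
  move=> j' jn' /=; case: (j' =P j) => [-> _|_ t']; last exact: sc3.
  by split=> //; apply/eqP.
have S2 : searched n el (live pd) (live td) c f m
    (upd (nmem s "pseen") (f j) 1) (upd (nmem s "tseen") j 1)
    (upd (nmem s "from") (f j) j) (upd (nmem s "tfrom") j i)
    (upd (nmem s "queue") (nmem s "qtail" 0) (f j)) (nmem s "qtail" 0 + 1).
  by apply: searched_push_task; rewrite // /upd eqxx.
have qlt q : q <= h -> (q == nmem s "qtail" 0) = false.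
  by move=> le; apply/eqP; lia.
put; rewrite jj.
split=> //=; first by rewrite qlt.
- by lia.
- by rewrite f0.
move=> _; split=> /=.
- by move=> q lt; rewrite qlt 1?ltnW //; apply: scm; apply: sc1.
- by [].
- move=> j' jn' /= H; case: (f j' =P f j) => [E|ne]; first by rewrite E.
  have [E|nj] := eqVneq j' j; first by rewrite E in ne.
  by rewrite (negbTE nj) in H; apply: sc3.
Qed.

Lemma runs_visit s h : flow_env s pd td f c -> h = nmem s "qhead" 0 ->
  visiting s h (nmem s "queue" h) 0 -> nmem s "found" 0 = 0 ->
  runs search_visit s (n * 120 + 60) (fun s' =>
    [/\ flow_env s' pd td f c, nmem s' "qhead" 0 = h.+1 &
       exists2 j, visiting s' h (nmem s "queue" h) j &
         j < n -> nmem s' "found" 0 != 0]).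
Proof.
move=> E hh V f0; rewrite /search_visit.
apply: (@runs_step_seq _ _ _ _ 10 (n * 120 + 50)) => //; last lia.
rewrite step_put /=.
apply: (@runs_step_seq _ _ _ _ 10 (n * 120 + 40)) => //; last lia.
rewrite step_put /= -hh.
apply: (@runs_step_seq _ _ _ _ 10 (n * 120 + 30)) => //; last lia.
rewrite step_put /=; set s1 := nput _ _ _ _.
have E1 : flow_env s1 pd td f c by case: E => [[]].
apply: runs_weaken; first apply: (@runs_while _ _ _
  (fun k s' => exists j, [/\ j + k = n, visiting s' h (nmem s "queue" h) j
    & nmem s' "j" 0 = j]) 100 n).
- by exists 0; split=> //; case: V.
- move=> k s' F [j [jk V' jj]]; have E' := flow_env_frame F isT isT E1.
  rewrite /= jj (env_n E') !nat_of_bool_neq0 => /andP[/eqP f'0 jn].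
  apply: runs_step => //; exists k.-1; first lia.
  exists j.+1; split; first lia.
    by apply: step_scan => //; have [-> //] := F.
  rewrite /search_scan step_seq step_put /=.
  by rewrite (step_frame _ _).1 // jj addn1.
- exact: leqnn.
- rewrite /=; lia.
- move=> s' [[k [j [jk V' jj]]] ev F] _; have E' := flow_env_frame F isT isT E1.
  split=> //; first by have [-> //] := F; rewrite /s1 /= addn1.
  exists j => // jn; move: ev => /eqP; rewrite /= jj (env_n E') jn.
  by rewrite !nat_of_bool_neq0 andbT eqb0.
Qed.

Lemma step_init s i : flow_env s pd td f c -> i < m -> reached s i ->
  nmem s "i" 0 = i -> reached (step search_init s) i.+1.
Proof.
move=> [[Em En Ee Ep Et] Ea El Ec] im S ii; rewrite /search_init.
put; rewrite step_if /= !nat_of_bool_neq0 ii Ep Ec El //.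
case: ifP => [/andP[Pi ci]|/negbT H].
  put; rewrite ii En.
  exact: (searched_push_source S).
rewrite step_skip; exact: (searched_skip S).
Qed.

(** Each visit takes one processor off the queue, which never holds more than [m] entries, and scans
    at most [n] tasks; hence O(mn). *)
Lemma runs_find s : flow_env s pd td f c ->
  runs find_augmenting_path s (300 * (m.+1 * n.+1)) (fun s' =>
    [/\ reached s' m, nmem s' "found" 0 != 0 -> found_path s'
      & nmem s' "found" 0 = 0 -> source_cut m n el (live pd) (live td) c f
          (fun i => (i < m) && (nmem s' "pseen" i != 0))]).
Proof.
move=> E; rewrite find_augmenting_pathE.
pose W := m * (n * 120 + 80) + 20.
apply: (@runs_step_seq _ _ _ _ 10 (W + m * 80 + n * 20 + 60)) => //; last lia.
apply: (@runs_step_seq _ _ _ _ 10 (W + m * 80 + n * 20 + 50)) => //; last lia.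
apply: (@runs_step_seq _ _ _ _ 10 (W + m * 80 + n * 20 + 40)) => //; last lia.
put; set s1 := nput _ _ _ _.
have E1 : flow_env s1 pd td f c by case: E => [[]].
apply: (@runs_seq _ _ _ _ (n * 20 + 20) (W + m * 80 + 20)); last lia.
  apply: (@runs_for _ _ _ _ n
    (fun i s' => forall j, j < i -> nmem s' "tseen" j = 0) 8) => //.
  - by move=> i s' F _; apply: (env_n (flow_env_frame F _ _ E1)).
  - move=> i s' lt F I ii; apply: runs_step => //; put.
    move=> j jl; rewrite ii; case: (j =P i) => // ne; apply: I; lia.
  - by rewrite /=; lia.
move=> s2 t0 F2; have E2 := flow_env_frame F2 isT isT E1.
apply: (@runs_seq _ _ _ _ (m * 80 + 20) W); last lia.
  apply: (@runs_for _ _ _ _ m (fun i s' => reached s' i) 60) => //.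
  - rewrite /reached /=.
    have -> : nmem s2 "qtail" 0 = 0 by rewrite F2.1.
    exact: searched_init.
  - by move=> i s' F _; apply: (env_m (flow_env_frame F _ _ E2)).
  - move=> i s' lt F I ii; apply: runs_step => //.
    by have := step_init (flow_env_frame F isT isT E2) lt I ii.
  - by rewrite /=; lia.
move=> s3 S3 F3; have E3 := flow_env_frame F3 isT isT E2.
have ts3 : nmem s3 "tseen" = nmem s2 "tseen" by rewrite F3.1.
have f3 : nmem s3 "found" 0 = 0 by rewrite F3.1 // F2.1.
apply: runs_weaken; first apply: (@runs_while _ _ _
  (fun k s' => [/\ nmem s' "qhead" 0 + k = m, reached s' m,
     nmem s' "qhead" 0 <= nmem s' "qtail" 0,
     nmem s' "found" 0 != 0 -> found_path s'
   & nmem s' "found" 0 = 0 -> (forall q, q < nmem s' "qhead" 0 ->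
        scanned el (live td) f (nmem s' "tseen") (nmem s' "queue" q) n) /\
        seen_closed s']) (n * 120 + 60) m).
- have -> : nmem s3 "qhead" 0 = 0 by rewrite F3.1 // F2.1.
  split=> //; first by rewrite f3.
  by move=> _; split=> // j jn; rewrite ts3 t0.
- move=> k s' F [hk S' hq fo sc]; have E' := flow_env_frame F isT isT E3.
  rewrite /= !nat_of_bool_neq0 => /andP[/eqP f'0 lt].
  have [sc1 sc2] := sc f'0.
  have V : visiting s' (nmem s' "qhead" 0)
      (nmem s' "queue" (nmem s' "qhead" 0)) 0 by split.
  apply: runs_weaken (runs_visit E' erefl V f'0) (leqnn _) _.
  move=> s4 [E4 h4 [j [qi S4 hq4 fo4 sc4] jn4]] F4; exists k.-1.
    by have := searched_size S'; lia.
  rewrite h4; split=> //; first by have := searched_size S'; lia.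
  move=> f40; have [sc5 sc6 sc7] := sc4 f40; split=> // q.
  have nj : n <= j by rewrite leqNgt; apply/negP => /jn4; rewrite f40.
  rewrite ltnS leq_eqVlt => /orP[/eqP->|]; last exact: sc5.
  by rewrite qi => j' j'n; apply: sc6; lia.
- exact: leqnn.
- by rewrite /= /W; lia.
- move=> s' [[k [hk S' hq fo sc]] ev F] _; split=> // f'0.
  have [sc1 sc2] := sc f'0; move/eqP: ev.
  rewrite /= !nat_of_bool_neq0 f'0 /= eqb0 -leqNgt => qh.
  apply: (searched_cut S') => // q qt; apply: sc1; lia.
Qed.

(** Only the processor at the start of the path gains a task, so no load decreases; [cut_extend]
    relies on this when the capacity is raised. *)
Lemma runs_augment s : flow_env s pd td f c -> reached s m -> found_path s ->
  (forall i, i < m -> cnt n f i <= c) ->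
  nmem s "val" 0 = \sum_(j < n) (f j < m) ->
  runs augment s (100 * m.+1) (fun s' => exists f',
    [/\ flow_env s' pd td f' c, flow m n el (live pd) (live td) f',
      nmem s' "val" 0 = \sum_(j < n) (f' j < m),
      \sum_(j < n) (f' j < m) = (\sum_(j < n) (f j < m)).+1
    & forall i, i < m -> cnt n f i <= cnt n f' i <= c]).
Proof.
move=> E S [ln tl fl] cap vs; have [[Em En Ee Ep Et] Ea El Ec] := E.
have [q0 [q0t tq0 RR]] := rerouting_start ff S ln tl fl.
have qm := searched_size S; rewrite /augment.
apply: (@runs_step_seq _ _ _ _ 10 (100 * m + 80)) => //; last lia.
apply: (@runs_step_seq _ _ _ _ 10 (100 * m + 70)) => //; last lia.
apply: (@runs_step_seq _ _ _ _ 10 (100 * m + 60)) => //; last lia.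
put; set s1 := nput _ _ _ _.
have E1 : env s1 pd td by [].
apply: (@runs_seq _ _ _ _ (100 * m + 20) 40).
(* The variant is the queue position of the overloaded processor, which drops along the path. *)
- apply: (@runs_while _ _ _ (fun q s' => [/\ q < nmem s "qtail" 0,
    rerouting m n el (live pd) (live td) f (nmem s' "asg") (nmem s "from")
      (nmem s "tfrom") (nmem s "queue") q & nmem s' "i" 0 = nmem s "queue" q])
    50 q0).
  + by split=> //=; rewrite Ea.
  + move=> q s' F [qt RR' iq]; have E' := env_frame F isT E1.
    have Fr : nmem s' "from" = nmem s "from" by rewrite F.1.
    have Ft : nmem s' "tfrom" = nmem s "tfrom" by rewrite F.1.
    rewrite /= (env_n E') iq Fr nat_of_bool_neq0 => lt.
    apply: runs_step => //; put; rewrite iq Fr Ft.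
    have [q' [lt' tq' RR2]] := rerouting_next S qt RR' lt.
    by exists q' => //; split=> //; lia.
  + by rewrite /=; lia.
- move=> s2 [[q [qt RR2 iq]] ev F] _; have E2 := env_frame F isT E1.
  have Fr : nmem s2 "from" = nmem s "from" by rewrite F.1.
  (* The loop stops at a processor reached from the source; it had spare capacity under [f] and
     absorbs the surplus task. *)
  move: ev => /eqP; rewrite /= (env_n E2) iq Fr eqb0 => /negP nfr.
  have [im _ _ H] := searched_queue S qt.
  have ci : cnt n f (nmem s "queue" q) < c.
    by case: H => [[_ //]|[]]; move: nfr; case: ltnP.
  apply: runs_step => //; put; rewrite iq; exists (nmem s2 "asg").
  have [R1 R2 R3 R4] := RR2.
  have Fl : nmem s2 "load" = nmem s "load" by rewrite F.1.
  have Fv : nmem s2 "val" 0 = nmem s "val" 0 by rewrite F.1.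
  split=> //=.
  + split=> //=; first by case: E2.
      by move=> i im'; rewrite Fl R2 // !El //; case: (i =P _) => [->|_]; rewrite ?addn0.
    by rewrite F.1.
  + by rewrite R4 Fv vs addn1.
  + move=> i im'; rewrite R2 // leq_addr /=; case: (i =P _) => [->|_]; last by rewrite addn0 cap.
    by rewrite addn1.
- by lia.
Qed.

End Search.

(** * Maximum flows *)

Record flow_state s pd td f c : Prop := FlowState {
  flow_state_env :> flow_env s pd td f c;
  flow_state_flow : flow m n el (live pd) (live td) f;
  flow_state_cap : forall i, i < m -> cnt n f i <= c;
  flow_state_val : nmem s "val" 0 = \sum_(j < n) (f j < m) }.

Lemma runs_max_flow s pd td f c : flow_state s pd td f c ->
  runs max_flow s (n.+2 * (500 * (m.+1 * n.+1))) (fun s' => exists f',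
    [/\ flow_state s' pd td f' c, forall i, i < m -> cnt n f i <= cnt n f' i
      & exists A, source_cut m n el (live pd) (live td) c f' A]).
Proof.
move=> FS; rewrite /max_flow.
have sle g : \sum_(j < n) (g j < m) <= n.
  by rewrite -[leqRHS]card_ord -sum1_card leq_sum // => j _; case: (_ < _).
apply: (@runs_step_seq _ _ _ _ 10 (n.+1 * (450 * (m.+1 * n.+1)) + 10)) => //; last by lia.
put.
(* The flow value grows with each successful search and is at most [n]; the extra 1 in [n.+1] counts
   the search that fails. *)
apply: runs_weaken; first apply: (@runs_while _ _ _
  (fun k s' => exists f', [/\ flow_state s' pd td f' c,
      forall i, i < m -> cnt n f i <= cnt n f' i,
      nmem s' "found" 0 != 0 -> k = n.+1 - \sum_(j < n) (f' j < m)
    & nmem s' "found" 0 = 0 -> exists A, source_cut m n el (live pd) (live td) c f' A])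
  (440 * (m.+1 * n.+1)) (n.+1 - \sum_(j < n) (f j < m))).
- by exists f; split=> //; case: FS => [[[]]].
- move=> k s' F [f' [FS' mono kk _]] /= ne; rewrite kk //.
  have [E' ff' cap' val'] := FS'.
  apply: (@runs_seq _ _ _ _ (300 * (m.+1 * n.+1)) (110 * (m.+1 * n.+1))); last lia.
    exact: (runs_find ff' E').
  move=> s1 [S1 fo1 cu1] F1; have E1 := flow_env_frame F1 isT isT E'.
  have val1 : nmem s1 "val" 0 = \sum_(j < n) (f' j < m) by rewrite F1.1.
  apply: (@runs_if _ _ _ _ _ (100 * m.+1)) => /=; last by lia.
    move=> f1; apply: runs_weaken; first exact: (runs_augment ff' E1 S1 (fo1 f1)).
      exact: leqnn.
    move=> s2 [f2 [E2 ff2 val2 sum2 mono2]] F2.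
    have := sle f2; rewrite sum2 => le.
    exists (n.+1 - \sum_(j < n) (f2 j < m)); first by rewrite sum2; move: (\sum_(j < n) (f' j < m)) le => X; lia.
    exists f2; split=> //.
    + by split=> // i im; case/andP: (mono2 i im).
    + by move=> i im; case/andP: (mono2 i im) => h _; apply: leq_trans h; apply: mono.
    + by rewrite F2.1 // => h; rewrite h in f1.
  move=> f1; apply: runs_step => //; rewrite step_skip.
  exists 0; first by rewrite subn_gt0 ltnS sle.
  exists f'; split=> //; first by rewrite f1.
  by eexists; apply: cu1.
- exact: leqnn.
- rewrite leq_add // leq_mul //=; [exact: leq_subr|lia].
- by move=> s' [[k [f' [FS' mono _ cu]]] ev F] _; exists f'; split=> //; apply: cu.
Qed.

(** * Binary search for the least sufficient capacity *)

Definition nlive (td : nat -> nat) := \sum_(j < n) live td j.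

Lemma assigned_le_nlive pd td f : flow m n el (live pd) (live td) f ->
  \sum_(j < n) (f j < m) <= nlive td.
Proof.
move=> ff; apply: leq_sum => j _; case: (ff j (ltn_ord j)) => [->|[_ _ -> _]].
  by rewrite ltnn.
by case: (_ < _).
Qed.

(** Justifies the test [val == rem]: the left sum is termwise at most the right one, so equal totals
    force equality for each task. *)
Lemma coversP pd td f : flow m n el (live pd) (live td) f ->
  reflect (covers m n (live td) f) (\sum_(j < n) (f j < m) == nlive td).
Proof.
move=> ff.
have pw (j : 'I_n) : (f j < m : nat) <= live td j ?= iff ((f j < m) == live td j).
  split; last by case: (_ < _); case: (live _ _).
  by case: (ff j (ltn_ord j)) => [->|[-> _ -> _]]; rewrite ?ltnn.
have [_ ->] := leqif_sum (fun j (_ : predT j) => pw j).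
apply: (iffP forall_inP) => [H j jn Tj|H j _].
  by have /eqP -> := H (Ordinal jn) isT.
apply/eqP; case: (boolP (live td j)) => [|nT]; first exact: H.
case: (ff j (ltn_ord j)) => [->|[_ _]]; first by rewrite ltnn.
by rewrite (negbTE nT).
Qed.

(** Together with [not_sufficient0], this gives the initial bounds of the binary search. *)
Lemma covers_sufficient pd td f : flow m n el (live pd) (live td) f ->
  covers m n (live td) f ->
  sufficient m n el (live pd) (live td) (nlive td).
Proof.
move=> ff cf; exists f => // i im; apply: leq_trans (assigned_le_nlive ff).
by apply: leq_sum => j _; case: eqP => // ->; rewrite im.
Qed.

Lemma not_sufficient0 pd td : 0 < nlive td ->
  ~ sufficient m n el (live pd) (live td) 0.
Proof.
move=> pos [f [ff cf] f0]; move: pos; rewrite -(eqP (introT (coversP ff) cf)).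
rewrite big1 // => j _; case: ltnP => // lt; have := f0 _ lt.
by rewrite /cnt (bigD1 j) //= eqxx.
Qed.

Lemma flow_state_set_c s pd td f c c' : flow_state s pd td f c ->
  (forall i, i < m -> cnt n f i <= c') ->
  flow_state (nput s "c" 0 c') pd td f c'.
Proof. by move=> [[[? ? ? ? ?] ? ? ?] ? _ ?] ?. Qed.

Lemma runs_zero_flow s pd td : env s pd td ->
  runs zero_flow s (40 * (m.+1 * n.+1)) (fun s' => exists2 f,
    forall i, i < m -> cnt n f i = 0 &
    flow_state s' pd td f (nmem s "c" 0)).
Proof.
move=> E; rewrite /zero_flow.
apply: (@runs_seq _ _ _ _ (m * 20 + 15) (n * 20 + 20)); last lia.
  apply: (@runs_for _ _ _ _ m
    (fun i s' => forall i', i' < i -> nmem s' "load" i' = 0) 8) => //.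
  - by move=> i s' F _; apply: (env_m (env_frame F _ E)).
  - move=> i s' lt F I ii; apply: runs_step => //; rewrite step_put /=.
    by move=> j jl; rewrite ii; case: (j =P i) => // ne; apply: I; lia.
  - by rewrite /=; lia.
move=> s1 l0 F1; have E1 := env_frame F1 isT E.
apply: (@runs_seq _ _ _ _ (n * 20 + 15) 5); last lia.
  apply: (@runs_for _ _ _ _ n
    (fun i s' => forall j, j < i -> nmem s' "asg" j = m) 8) => //.
  - by move=> i s' F _; apply: (env_n (env_frame F _ E1)).
  - move=> i s' lt F I ii; apply: runs_step => //; rewrite step_put /=.
    have -> := env_m (env_frame F isT E1).
    by move=> j jl; rewrite ii; case: (j =P i) => // ne; apply: I; lia.
  - by rewrite /=; lia.
move=> s2 a0 F2; have E2 := env_frame F2 isT E1.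
apply: runs_step => //; rewrite step_put /=.
have c0 i : i < m -> cnt n (nmem s2 "asg") i = 0.
  move=> im; rewrite /cnt big1 // => j _; rewrite a0 //.
  by have -> : m == i = false by lia.
exists (nmem s2 "asg") => //; split=> /=.
- split=> //=; first by case: E2.
    by move=> i im; rewrite c0 // F2.1 // l0.
  by rewrite F2.1 // F1.1.
- by move=> j jn; left; apply: a0.
- by move=> i im; rewrite c0.
- by rewrite big1 // => j _; rewrite a0 // ltnn.
Qed.

(** The input of [excess_exchange], with [B] the sink side of a minimum cut for capacity [lo];
    [bottleneck_min] guarantees that some load exceeds [lo]. *)
Record bottleneck s pd td lo f (B : pred nat) : Prop := Bottleneck {
  bottleneck_asg : nmem s "asg" = f;
  bottleneck_load : forall i, i < m -> nmem s "load" i = cnt n f i;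
  bottleneck_flow : flow m n el (live pd) (live td) f;
  bottleneck_covers : covers m n (live td) f;
  bottleneck_sub : forall i, i < m -> B i -> live pd i;
  bottleneck_closed : forall i j, i < m -> j < n -> live td j -> live pd i ->
    el i j -> B (f j) -> B i;
  bottleneck_in : forall i, i < m -> B i -> lo <= cnt n f i;
  bottleneck_out : forall i, i < m -> live pd i -> ~~ B i -> cnt n f i <= lo;
  bottleneck_cap : forall i, i < m -> cnt n f i <= lo.+1;
  bottleneck_min : ~ sufficient m n el (live pd) (live td) lo }.

Lemma runs_min_max_assignment s pd td L : env s pd td ->
  nmem s "rem" 0 = nlive td -> 0 < nlive td ->
  sufficient m n el (live pd) (live td) (nlive td) -> nlive td <= 2 ^ L ->
  runs min_max_assignment s ((L + 4) * (n.+2 * (700 * (m.+1 * n.+1))))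
    (fun s' => exists lo f B, bottleneck s' pd td lo f B).
Proof.
move=> E rr pos suf rL; rewrite /min_max_assignment.
(* [M] pays for one maximum flow, multiples of [X] for the cheaper commands. *)
pose X := m.+1 * n.+1; pose M := n.+2 * (500 * X).
have leM : 1000 * X <= M by rewrite /M; lia.
have X0 : 0 < X by rewrite muln_gt0.
have -> : n.+2 * (700 * (m.+1 * n.+1)) = M + n.+2 * (200 * X) by rewrite -mulnDr /M; lia.
have le2 : 400 * X <= n.+2 * (200 * X) by lia.
move: (n.+2 * (200 * X)) le2 => Y le2.
have flow_eq g s1 : flow m n el (live pd) (live td) g ->
    nmem s1 "val" 0 = \sum_(j < n) (g j < m) -> nmem s1 "rem" 0 = nlive td ->
    reflect (covers m n (live td) g) (nmem s1 "val" 0 == nmem s1 "rem" 0).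
  by move=> fg -> ->; apply: (coversP fg).
apply: (@runs_step_seq _ _ _ _ 10 ((L + 3) * (M + Y) + 10)) => //; last lia.
apply: (@runs_step_seq _ _ _ _ 10 ((L + 3) * (M + Y))) => //; last lia.
put; rewrite rr; set s1 := nput _ _ _ _.
have E1 : env s1 pd td by case: E.
apply: (@runs_seq _ _ _ _ (L * (M + Y) + 10) (3 * (M + Y) - 10)); last lia.
  (* The variant [k] bounds the length of the interval by [2 ^ k], so one halving lowers it by
     one. *)
  apply: (@runs_while _ _ _ (fun k s' => exists lo hi,
    [/\ nmem s' "lo" 0 = lo, nmem s' "hi" 0 = hi, lo < hi <= lo + 2 ^ k,
        sufficient m n el (live pd) (live td) hi
      & ~ sufficient m n el (live pd) (live td) lo]) (M + 60 * X) L).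
  - exists 0, (nlive td); split=> //; first by rewrite pos.
    exact: not_sufficient0.
  - move=> k s2 F2 [lo [hi [elo ehi /andP[lt le] shi nslo]]].
    have E2 := env_frame F2 isT E1.
    have r2 : nmem s2 "rem" 0 = nlive td by rewrite F2.1.
    rewrite /= elo ehi nat_of_bool_neq0 => lt2.
    (* For [k = 0] the interval has length 1 and the loop test fails. *)
    case: k le => [|k] le; first by rewrite expn0 in le; lia.
    apply: (@runs_step_seq _ _ _ _ 10 (M + 50 * X)) => //; last lia.
    put; rewrite elo ehi; set c := half _; set s3 := nput _ _ _ _.
    have E3 : env s3 pd td by case: E2.
    apply: (@runs_seq _ _ _ _ (40 * X) (M + 10 * X)); last lia.
      exact: (runs_zero_flow E3).
    move=> s4 [g g0 FS4] F4.
    apply: (@runs_seq _ _ _ _ M (10 * X)); last lia.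
      exact: (runs_max_flow FS4).
    move=> s5 [g' [FS5 mono [A cu]]] F5.
    have r5 : nmem s5 "rem" 0 = nlive td by rewrite F5.1 // F4.1.
    have c5 : nmem s5 "c" 0 = c by have := flow_env_c FS5; rewrite /s3 /=.
    have lo5 : nmem s5 "lo" 0 = lo by rewrite F5.1 // F4.1.
    have hi5 : nmem s5 "hi" 0 = hi by rewrite F5.1 // F4.1.
    have cv := flow_eq g' s5 (flow_state_flow FS5) (flow_state_val FS5) r5.
    have cE : lo < c /\ c < hi /\ hi <= c + 2 ^ k /\ c <= lo + 2 ^ k.
      by rewrite /c; rewrite expnS in le; lia.
    apply: runs_step => //=; first by lia.
    rewrite step_if /= nat_of_bool_neq0; case: cv => cv; put; rewrite c5;
      exists k => //.
    + exists lo, c; split=> //; [lia|].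
      exists g' => //; first by split=> //; case: FS5.
      exact: (flow_state_cap FS5).
    + exists c, hi; split=> //; [lia|].
      exact: (cut_insufficient (flow_state_flow FS5) cv cu).
  - by rewrite leq_add // leq_mul //=; lia.
move=> s2 [[k [lo [hi [elo ehi /andP[lt le] shi nslo]]]] ev F2] _.
have E2 := env_frame F2 isT E1.
have r2 : nmem s2 "rem" 0 = nlive td by rewrite F2.1.
have hlo : hi = lo.+1.
  by move/eqP: ev; rewrite /= elo ehi eqb0; lia.
apply: (@runs_seq _ _ _ _ (40 * X) (2 * M + 40 * X)); last lia.
  exact: (runs_zero_flow E2).
move=> s3 [g g0 FS3] F3.
apply: (@runs_step_seq _ _ _ _ 10 (2 * M + 30 * X)) => //; last lia.
put; have -> : nmem s3 "lo" 0 = lo by rewrite F3.1.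
have FS4 := flow_state_set_c FS3 (c' := lo) (fun i im => ltac:(by rewrite g0)).
apply: (@runs_seq _ _ _ _ M (M + 30 * X)); last lia.
  exact: (runs_max_flow FS4).
move=> s5 [f1 [FS5 mono1 [A cu1]]] F5.
apply: (@runs_step_seq _ _ _ _ 10 (M + 20 * X)) => //; last lia.
put; have -> : nmem s5 "hi" 0 = hi by rewrite F5.1 //= F3.1.
have FS6 := flow_state_set_c FS5 (c' := hi)
  (fun i im => ltac:(rewrite hlo; exact: leqW (flow_state_cap FS5 im))).
apply: runs_weaken; [exact: (runs_max_flow FS6)|by rewrite -/X -/M; lia|].
move=> s7 [f2 [FS7 mono2 [A2 cu2]]] F7.
have ff2 := flow_state_flow FS7.
(* Otherwise the final cut would show [hi] to be insufficient. *)
have cv2 : covers m n (live td) f2.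
  apply/(coversP ff2); case: (coversP ff2) => // ncv.
  by case: (cut_insufficient ff2 ncv cu2).
(* [f2] arises from [f1] by augmentations, so [mono2] supplies the monotonicity of the loads that
   [cut_extend] asks for. *)
have [B1 B2 B3] := cut_extend (flow_state_flow FS5) (flow_state_cap FS5) cu1
  ff2 cv2 mono2.
exists lo, f2, (fun i => live pd i && ~~ A i); split=> //.
- exact: (flow_env_asg FS7).
- exact: (flow_env_load FS7).
- by move=> i im /andP[].
- by rewrite -hlo; exact: (flow_state_cap FS7).
Qed.

(** * Rounds of the algorithm *)

Lemma runs_fix_max_load_processor s pd td f : env s pd td ->
  nmem s "asg" = f -> (forall i, i < m -> nmem s "load" i = cnt n f i) ->
  (exists i, [/\ i < m, live pd i & 0 < cnt n f i]) ->
  runs fix_max_load_processor s (200 * (m.+1 * n.+1)) (fun s' =>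
    exists p td', [/\ p < m /\ live pd p,
      forall i, i < m -> live pd i -> cnt n f i <= cnt n f p,
      env s' (upd pd p 1) td',
      forall j, j < n -> live td' j = live td j && (f j != p)
    & [/\ forall j, j < n -> nmem s' "proc" j =
        if live td j && (f j == p) then p else nmem s "proc" j
      & nmem s' "rem" 0 = nlive td']]).
Proof.
move=> E Ea El [i0 [i0m P0 c0]]; rewrite /fix_max_load_processor.
apply: (@runs_step_seq _ _ _ _ 10 (m * 60 + n * 60 + 90)) => //; last lia.
apply: (@runs_step_seq _ _ _ _ 10 (m * 60 + n * 60 + 80)) => //; last lia.
put; set s1 := nput _ _ _ _.
have E1 : env s1 pd td by case: E.
apply: (@runs_seq _ _ _ _ (m * 60 + 20) (n * 60 + 60)); last lia.
  (* [best] starts at 0 and the test is strict, so [p] is meaningful only once a positive load has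
     been met. *)
  apply: (@runs_for _ _ _ _ m (fun i s' =>
    (forall i', i' < i -> live pd i' -> cnt n f i' <= nmem s' "best" 0) /\
    (0 < nmem s' "best" 0 -> [/\ nmem s' "p" 0 < m, live pd (nmem s' "p" 0)
       & cnt n f (nmem s' "p" 0) = nmem s' "best" 0])) 40) => //.
  - by move=> i s' F _; apply: (env_m (env_frame F _ E1)).
  - move=> i s' lt F [I1 I2] ii; apply: runs_step => //.
    have E' := env_frame F isT E1.
    have l' : nmem s' "load" i = cnt n f i by rewrite F.1 //= El.
    rewrite step_if /= !nat_of_bool_neq0 ii (env_pdone E') l'.
    case: ifP => [/andP[Pi lti]|H].
      put; rewrite ii l'; split=> // i'.
      rewrite ltnS leq_eqVlt => /orP[/eqP->//|lt'] P'.
      by apply: leq_trans (I1 i' lt' P') _; apply: ltnW.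
    rewrite step_skip /=; split=> // i'.
    rewrite ltnS leq_eqVlt => /orP[/eqP->|lt'] P'; last exact: I1.
    by move: H; rewrite [_ == _]P' /= => /negbT; rewrite -leqNgt.
  - by rewrite /=; lia.
move=> s2 [I1 I2] F2; have E2 := env_frame F2 isT E1.
have b0 : 0 < nmem s2 "best" 0 by apply: leq_trans c0 _; apply: I1.
have [pm Pp cp] := I2 b0; set p := nmem s2 "p" 0 in pm Pp cp.
have a2 : nmem s2 "asg" = f by rewrite F2.1.
apply: (@runs_step_seq _ _ _ _ 10 (n * 60 + 50)) => //; last lia.
apply: (@runs_step_seq _ _ _ _ 10 (n * 60 + 40)) => //; last lia.
put; rewrite -/p; set s3 := nput _ _ _ _.
have [Em En Ee Ep Et] := E2.
apply: (@runs_seq _ _ _ _ (n * 60 + 20) 10); last lia.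
  (* [tdone] is overwritten in place: it is new below [k] and still agrees with [td] from [k] on. *)
  apply: (@runs_for _ _ _ _ n (fun k s' =>
    [/\ forall j, j < k -> live (nmem s' "tdone") j = live td j && (f j != p),
        forall j, k <= j -> nmem s' "tdone" j = td j,
        forall j, nmem s' "proc" j = if [&& j < k, live td j & f j == p]
          then p else nmem s "proc" j
      & nmem s' "left" 0 = \sum_(l < k) (live td l && (f l != p))]) 45) => //.
  - split=> //=; [by rewrite Et|by move=> j; rewrite F2.1|by rewrite big_ord0].
  - by move=> i s' F _ /=; rewrite F.1.
  - move=> k s' lt F [J1 J2 J3 J4] jj; apply: runs_step => //.
    have Fa : nmem s' "asg" = f by rewrite F.1.
    have Fp : nmem s' "p" 0 = p by rewrite F.1.
    rewrite step_if /= nat_of_bool_neq0 jj J2 // -[td k == 0]/(live td k).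
    have ltSE j : (j < k.+1) = (j == k) || (j < k) by rewrite ltnS leq_eqVlt.
    case Tk: (live td k); last first.
      rewrite step_skip /=; split=> //.
      + by move=> j; rewrite ltSE => /orP[/eqP->|]; [rewrite /live J2 // -/(live td k) Tk|exact: J1].
      + by move=> j jk; apply: J2; apply: ltnW.
      + move=> j; rewrite J3 ltSE; case: (j =P k) => //= ->.
        by rewrite Tk /= andbF.
      + by rewrite big_ord_recr /= Tk addn0.
    rewrite step_if /= nat_of_bool_neq0 jj Fa Fp; case: (f k =P p) => fk.
      put; rewrite jj Fp; split=> //.
      + move=> j; rewrite /live /=; case: (j =P k) => [->|ne] jk; last by apply: J1; lia.
        by rewrite fk eqxx andbF.
      + move=> j jk /=; have -> : j == k = false by lia.
        by apply: J2; lia.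
      + move=> j /=; rewrite ltSE; case: (j =P k) => //= ->.
        by rewrite Tk fk eqxx.
      + by rewrite big_ord_recr /= Tk fk eqxx addn0.
    put; split=> //=.
    + by move=> j; rewrite ltSE => /orP[/eqP->|]; [rewrite /live J2 // -/(live td k) Tk; case: eqP|exact: J1].
    + by move=> j jk; apply: J2; apply: ltnW.
    + move=> j; rewrite J3 ltSE; case: (j =P k) => //= ->.
      by rewrite ltnn; case: eqP => // E'; rewrite andbF.
    + by rewrite big_ord_recr /= Tk J4; case: eqP.
  - by rewrite /=; lia.
move=> s4 [J1 J2 J3 J4] F4; apply: runs_step => //; put.
exists p, (nmem s4 "tdone"); split=> //=.
- by move=> i im Pi; rewrite cp; apply: I1.
- split=> //=; first by rewrite F4.1.
  + by rewrite F4.1.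
  + by move=> i j im jn; rewrite F4.1 //= Ee.
  + by rewrite F4.1 //= Ep.
- split=> //; first by move=> j jn; rewrite J3 jn.
  by rewrite J4; apply: eq_bigr => j _; rewrite J1.
Qed.

(** [b'] depends on [d]; only when no task is live do all these completions coincide with the
    output. Live tasks sit exactly on live processors, so that a round can work on the remaining
    network alone. *)
Record partial_optimum s pd td : Prop := PartialOptimum {
  partial_optimum_env : env s pd td;
  partial_optimum_rem : nmem s "rem" 0 = nlive td;
  partial_optimum_extend : forall d b, legal m n el b ->
    exists b', [/\ legal m n el b',
      forall j, j < n -> ~~ live td j -> b' j = nmem s "proc" j,
      forall j, j < n -> live td j = live pd (b' j)
    & excess m n d b' <= excess m n d b] }.

(** Shows that the remaining network can still route all remaining tasks. *)
Lemma legal_flow pd td b : legal m n el b ->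
  (forall j, j < n -> live td j = live pd (b j)) ->
  exists2 f, flow m n el (live pd) (live td) f & covers m n (live td) f.
Proof.
move=> lb Tb; exists (fun j => if live td j then b j else m).
  move=> j jn; case: ifP => Tj; [right|by left].
  by have [? ?] := lb j jn; split=> //; rewrite -Tb.
by move=> j jn Tj; rewrite Tj; have [] := lb j jn.
Qed.

Lemma runs_round s pd td L b0 : legal m n el b0 ->
  partial_optimum s pd td -> 0 < nlive td -> n <= 2 ^ L ->
  runs (Seq min_max_assignment fix_max_load_processor) s
    ((L + 5) * (n.+2 * (700 * (m.+1 * n.+1)))) (fun s' => exists pd' td',
      nlive td' < nlive td /\ partial_optimum s' pd' td').
Proof.
move=> lb0 [E rr ext] pos nL.
have [b1 [lb1 _ T1 _]] := ext 0 b0 lb0.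
have [f0 ff0 cf0] := legal_flow lb1 T1.
have rn : nlive td <= 2 ^ L.
  apply: leq_trans nL; rewrite -[leqRHS]card_ord -sum1_card leq_sum // => j _.
  by case: (live _ _).
apply: (@runs_seq _ _ _ _ ((L + 4) * (n.+2 * (700 * (m.+1 * n.+1))))
  (200 * (m.+1 * n.+1))); last by lia.
  exact: (runs_min_max_assignment E rr pos (covers_sufficient ff0 cf0) rn).
move=> s1 [lo [f [B [Ea El ff cf B1 B2 B3 B4 B5 B6]]]] F1.
have E1 := env_frame F1 isT E.
have livef i : i < m -> 0 < cnt n f i -> live pd i.
  move=> im; rewrite lt0n; apply: contraR => nP; rewrite /cnt big1 // => j _.
  case: eqP => // E'; case: (ff j (ltn_ord j)) => [|[_]]; first lia.
  by rewrite E' (negbTE nP).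
(* As [lo] is insufficient, some load exceeds it; the processor chosen has maximum load, hence
   exactly [lo + 1]. *)
have [i [im ci]] : exists i, i < m /\ lo < cnt n f i.
  apply: contrapT => H; apply: B6; exists f => // i im.
  by rewrite leqNgt; apply/negP => ci; apply: H; exists i.
apply: runs_weaken; first apply: (runs_fix_max_load_processor E1 Ea El).
- by exists i; split=> //; [apply: livef => //|]; apply: leq_ltn_trans ci.
- exact: leqnn.
move=> s2 [p [td2 [[pm Pp] cmax E2 T2 [pr2 rem2]]]] F2.
have cp : cnt n f p = lo.+1.
  apply/eqP; rewrite eqn_leq B5 //=; apply: (leq_trans ci); apply: cmax => //.
  by apply: livef => //; apply: leq_ltn_trans ci.
exists (upd pd p 1), td2; split.
  (* The chosen processor hosts at least one live task, so the number of live tasks drops. *)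
  have [j [jn fj]] : exists j, j < n /\ f j = p.
    apply: contrapT => H; have : cnt n f p = 0; last by rewrite cp.
    rewrite /cnt big1 // => j _; case: eqP => // fj; case: H; exists j; split=> //.
  have Tj : live td j.
    by case: (ff j jn) => [|[]//]; rewrite fj => E'; rewrite E' ltnn in pm.
  rewrite /nlive (bigD1 (Ordinal jn)) //= [ltnRHS](bigD1 (Ordinal jn)) //=.
  rewrite T2 // Tj fj eqxx add0n add1n ltnS; apply: leq_sum => l _.
  by rewrite T2 //; case: (live td l) => //=; case: (_ != _).
split=> // d b lb; have [b' [lb' pb' Tb' le']] := ext d b lb.
have [b2 [lb2 off2 on2 le2]] := excess_exchange d ff cf B1 B2 B3 B4
  (fun i im _ => B5 i im) pm Pp cp lb' Tb'.
have pr1 : nmem s1 "proc" = nmem s "proc" by rewrite F1.1.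
exists b2; split=> //; last exact: leq_trans le'.
(* [b2] and [f] agree on which live tasks go to [p], so the tasks fixed in this round are hosted by
   [p] under [b2]. *)
- move=> j jn; rewrite T2 // pr2 // pr1; case Tj: (live td j) => /=.
    by have [_ <-] := on2 j jn Tj; rewrite negbK => /eqP ->; rewrite eqxx.
  by move=> _; rewrite off2 ?Tj // pb' ?Tj.
- move=> j jn; rewrite T2 //; case Tj: (live td j) => /=; rewrite /live /upd.
    have [Pb <-] := on2 j jn Tj; case: (b2 j =P p) => //= _.
  have := Tb' j jn; rewrite Tj off2 ?Tj // => /esym.
  by rewrite /live; case: (b' j =P p) => // _ ->.
Qed.

Definition assigned_optimally b :=
  legal m n el b /\
  forall d b', legal m n el b' -> excess m n d b <= excess m n d b'.

(** [L + 5] pays for a round; the extra unit absorbs the test of the outer loop. *)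
Definition round_budget L := (L + 6) * (n.+2 * (700 * (m.+1 * n.+1))).

Lemma round_budget_ge L : 1000 * (m.+1 * n.+1) <= round_budget L.
Proof.
have h : 6 * 2 <= (L + 6) * n.+2 by rewrite leq_mul //; lia.
rewrite /round_budget [leqRHS]mulnA.
by apply: leq_trans (leq_mul h (leqnn _)); lia.
Qed.

Lemma runs_rounds s L b0 : legal m n el b0 ->
  nmem s "m" 0 = m -> nmem s "n" 0 = n ->
  (forall i j, i < m -> j < n ->
    nmem s "elig" (i * n + j) = nat_of_bool (el i j)) -> n <= 2 ^ L ->
  runs (Seq (For "i" "m" (Put "pdone" "i" 0)) (Seq (For "j" "n" (Put "tdone" "j" 0))
    (Seq (Set_ "rem" "n")
      (While "rem" (Seq min_max_assignment fix_max_load_processor))))) s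
   (n.+1 * round_budget L)
   (fun s' => assigned_optimally (nmem s' "proc")).
Proof.
move=> lb0 Em En Ee nL.
have bud := round_budget_ge L.
apply: (@runs_seq _ _ _ _ (m * 20 + 20) (n * 20 + 40 + n * round_budget L)); last by rewrite mulSn; lia.
  apply: (@runs_for _ _ _ _ m
    (fun i s' => forall i', i' < i -> nmem s' "pdone" i' = 0) 8) => //.
  - by move=> i s' F _ /=; rewrite F.1.
  - move=> i s' lt F I ii; apply: runs_step => //; rewrite step_put /=.
    by move=> j jl; rewrite ii; case: (j =P i) => // ne; apply: I; lia.
  - by rewrite /=; lia.
move=> s1 l0 F1.
apply: (@runs_seq _ _ _ _ (n * 20 + 20) (20 + n * round_budget L)); last lia.
  apply: (@runs_for _ _ _ _ n
    (fun i s' => forall i', i' < i -> nmem s' "tdone" i' = 0) 8) => //.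
  - by move=> i s' F _ /=; rewrite F.1 // F1.1.
  - move=> i s' lt F I ii; apply: runs_step => //; rewrite step_put /=.
    by move=> j jl; rewrite ii; case: (j =P i) => // ne; apply: I; lia.
  - by rewrite /=; lia.
move=> s2 t0 F2.
have En2 : nmem s2 "n" 0 = n by rewrite F2.1 // F1.1.
have T2 j : j < n -> live (nmem s2 "tdone") j by move=> jn; rewrite /live t0.
apply: (@runs_step_seq _ _ _ _ 10 (10 + n * round_budget L)) => //.
put; rewrite En2.
apply: runs_weaken; first apply: (@runs_while _ _ _ (fun k s' => exists pd td,
    nlive td = k /\ partial_optimum s' pd td)
    ((L + 5) * (n.+2 * (700 * (m.+1 * n.+1)))) n).
- have nT : nlive (nmem s2 "tdone") = n.
    rewrite /nlive (eq_bigr (fun _ => 1)) ?sum1_card ?card_ord // => j _.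
    by rewrite T2.
  exists (nmem s2 "pdone"), (nmem s2 "tdone"); split=> //; split=> //=.
    split=> //=; first by rewrite F2.1 // F1.1.
    by move=> i j im jn; rewrite F2.1 // F1.1 // Ee.
  move=> d b lb; exists b; split=> //; first by move=> j jn; rewrite T2.
  move=> j jn; rewrite T2 //; apply/esym; have [bm _] := lb j jn.
  by rewrite /live F2.1 // l0.
- move=> k s' F [pd [td [<- PO]]]; rewrite /= (partial_optimum_rem PO) -lt0n => pos.
  apply: runs_weaken (runs_round lb0 PO pos nL) (leqnn _) _.
  move=> s3 [pd' [td' [lt PO']]] _; exists (nlive td') => //.
  by exists pd', td'.
- exact: leqnn.
- rewrite /= addnC leq_add //= leq_mul // /round_budget.
  rewrite addnS mulSn.
  have : 1 * 700 <= n.+2 * (700 * (m.+1 * n.+1)).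
    by rewrite leq_mul // -{1}[700]muln1 leq_mul2l /= muln_gt0.
  lia.
- move=> s' [[k [pd [td [_ [E rr ext]]]]] ev F] _.
  (* No task is live any more, so every completion agrees with [proc] on all tasks, whatever [d]. *)
  have nT j : j < n -> live td j = false.
    move: ev => /=; rewrite rr => /eqP; rewrite sum_nat_eq0 => /forall_inP H jn.
    by have := H (Ordinal jn) isT; rewrite /=; case: (live td j).
  have eqp b : (forall j, j < n -> ~~ live td j -> b j = nmem s' "proc" j) ->
      forall j, j < n -> b j = nmem s' "proc" j.
    by move=> H j jn; apply: H => //; rewrite nT.
  split=> [|d b lb].
    have [b1 [lb1 pb1 _ _]] := ext 0 b0 lb0.
    by move=> j jn; rewrite -(eqp _ pb1) //; apply: lb1.
  have [b1 [lb1 pb1 _ le]] := ext d b lb.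
  apply: leq_trans le; rewrite leq_eqVlt; apply/orP; left; apply/eqP.
  apply: eq_bigr => i _; congr (_ - _); apply: eq_bigr => j _.
  by rewrite (eqp _ pb1).
Qed.

(** * Speeds and the complete run *)

Lemma runs_set_speeds s : nmem s "m" 0 = m -> nmem s "n" 0 = n ->
  (forall j, j < n -> nmem s "proc" j < m) ->
  runs set_speeds s (200 * (m.+1 * n.+1)) (fun s' => forall i, i < m ->
    rmem s' "speed" i =
      ((\sum_(j < n | nmem s "proc" j == i) rmem s "w" j) / rmem s "C" 0)%R).
Proof.
move=> Em En pm; rewrite /set_speeds.
apply: (@runs_seq _ _ _ _ (m * 20 + 20) (n * 40 + m * 40 + 40)); last lia.
  apply: (@runs_for _ _ _ _ m
    (fun i s' => forall i', i' < i -> rmem s' "total" i' = 0%R) 8) => //.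
  - by move=> i s' F _ /=; rewrite F.1.
  - move=> i s' lt F I ii; apply: runs_step => //; rewrite step_rput /=.
    by move=> j jl; rewrite ii; case: (j =P i) => // ne; apply: I; lia.
  - by rewrite /=; lia.
move=> s1 t0 F1.
have p1 : nmem s1 "proc" = nmem s "proc" by rewrite F1.1.
apply: (@runs_seq _ _ _ _ (n * 40 + 20) (m * 40 + 20)); last lia.
  apply: (@runs_for _ _ _ _ n (fun k s' => forall i, i < m -> rmem s' "total" i =
     (\sum_(l < k | nmem s "proc" l == i) rmem s "w" l)%R) 25) => //.
  - by move=> i im /=; rewrite big_ord0 t0.
  - by move=> i s' F _ /=; rewrite F.1 // F1.1.
  - move=> k s' lt F I ii; apply: runs_step => //; rewrite step_rput /= ii.
    have -> : nmem s' "proc" = nmem s "proc" by rewrite F.1.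
    have -> : rmem s' "w" = rmem s "w" by rewrite F.2 // F1.2.
    move=> i im; rewrite big_mkcond big_ord_recr /= -big_mkcond /= -I //.
    case: (i =P nmem s "proc" k) => [->|ne]; first by rewrite eqxx.
    have -> : nmem s "proc" k == i = false by apply/eqP => E; apply: ne.
    by rewrite GRing.addr0.
  - by rewrite /=; lia.
move=> s2 tot F2.
apply: (@runs_weaken _ _ _ (m * 40 + 20) _ (fun s' => forall i, i < m ->
    rmem s' "speed" i = (rmem s2 "total" i / rmem s2 "C" 0)%R)) => //.
  apply: (@runs_for _ _ _ _ m (fun k s' => forall i, i < k -> 
    rmem s' "speed" i = (rmem s2 "total" i / rmem s2 "C" 0)%R) 25) => //.
  - by move=> i s' F _ /=; rewrite F.1 // F2.1 // F1.1.
  - move=> k s' lt F I ii; apply: runs_step => //; rewrite step_rput /= ii.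
    have -> : rmem s' "total" = rmem s2 "total" by rewrite F.2.
    have -> : rmem s' "C" = rmem s2 "C" by rewrite F.2.
    by move=> i jl; case: (i =P k) => [->//|ne]; apply: I; lia.
  - by rewrite /=; lia.
move=> s3 H _ i im; rewrite H // tot //.
by rewrite F2.2 // F1.2.
Qed.

(** Regroups the program so that [runs_rounds] covers everything before [set_speeds]. *)
Lemma runs_seq4A (a b c d e : cmd) s T Q :
  runs (Seq (Seq a (Seq b (Seq c d))) e) s T Q ->
  runs (Seq a (Seq b (Seq c (Seq d e)))) s T Q.
Proof.
move=> [t [s' [H le q]]]; exists t, s'; split=> // {le q}.
inversion H as [| | |? ? ? ta ? te ? H1 He| | | |]; subst.
inversion H1 as [| | |? ? ? t1 ? t2 ? Ha H2| | | |]; subst.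
inversion H2 as [| | |? ? ? t3 ? t4 ? Hb H3| | | |]; subst.
inversion H3 as [| | |? ? ? t5 ? t6 ? Hc Hd| | | |]; subst.
rewrite -!addnA; do 3 (econstructor; first eassumption).
by econstructor; eassumption.
Qed.

Lemma runs_algo s L b0 : legal m n el b0 ->
  nmem s "m" 0 = m -> nmem s "n" 0 = n ->
  (forall i j, i < m -> j < n ->
    nmem s "elig" (i * n + j) = nat_of_bool (el i j)) -> n <= 2 ^ L ->
  runs ECSEMRPP_Algo s (n.+2 * round_budget L) (fun s' =>
    assigned_optimally (nmem s' "proc") /\
    forall i, i < m -> rmem s' "speed" i =
      ((\sum_(j < n | nmem s' "proc" j == i) rmem s "w" j) / rmem s "C" 0)%R).
Proof.
move=> lb0 Em En Ee nL; apply: runs_seq4A.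
have bud := round_budget_ge L.
apply: (@runs_seq _ _ _ _ (n.+1 * round_budget L) (200 * (m.+1 * n.+1))).
- exact: (runs_rounds lb0).
- move=> s1 opt F1; have [leg _] := opt.
  apply: runs_weaken; first apply: runs_set_speeds.
  + by rewrite F1.1.
  + by rewrite F1.1.
  + by move=> j jn; have [] := leg j jn.
  + exact: leqnn.
  move=> s2 sp F2; have p2 : nmem s2 "proc" = nmem s1 "proc" by rewrite F2.1.
  rewrite p2; split=> // i im; rewrite sp // F1.2 //.
  by rewrite [rmem s1 "C"]F1.2.
- by rewrite mulSn; lia.
Qed.

End Flow.

(** * Energy *)

Section Schedules.
Local Open Scope classical_set_scope.
Local Open Scope ring_scope.

(** Young's inequality for x and v^(p-1) with the conjugate exponents p and p/(p-1); geometrically,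
    the tangent to x^p at v lies below the graph. *)
Lemma powR_tangent {R : realType} (x v p : R) : 0 <= x -> 0 <= v -> 1 < p ->
  p * (v `^ (p - 1) * x) <= x `^ p + (p - 1) * v `^ p.
Proof.
move=> x0 v0 p1; have p0 : 0 < p by lra.
have q0 : 0 < p / (p - 1) by rewrite divr_gt0 // subr_gt0.
have pq : p^-1 + (p / (p - 1))^-1 = 1.
  by field; rewrite !lt0r_neq0 //; lra.
have := conjugate_powR x0 (powR_ge0 v (p - 1)) p0 q0 pq.
rewrite -powRrM mulrCA divff ?mulr1; last by rewrite lt0r_neq0 //; lra.
have -> : x `^ p / p + v `^ p / (p / (p - 1)) = (x `^ p + (p - 1) * v `^ p) / p.
  by field; rewrite !lt0r_neq0 //; lra.
by rewrite ler_pdivlMr // mulrC [x * _]mulrC.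
Qed.

(** Sum of the tangent inequalities at [k + 1] for the points [k] and [k + 2]. *)
Lemma powR_midpoint {R : realType} (k p : R) : 0 <= k -> 1 < p ->
  2 * (k + 1) `^ p <= k `^ p + (k + 2) `^ p.
Proof.
move=> k0 p1; have k1 : 0 <= k + 1 by lra.
have k2 : 0 <= k + 2 by lra.
have := powR_tangent k0 k1 p1; have := powR_tangent k2 k1 p1.
have <- := mulr_powRB1 k1 (lt_trans ltr01 p1).
by set y := (k + 1) `^ _; nra.
Qed.

Section Energy.
Context {R : realType} {m n : nat}.
Variable I : instance R m n.
Let mu := @lebesgue_measure R.
Local Notation C := (deadline I).

Lemma measurable_horizon : measurable (horizon I).
Proof. exact: measurable_itv. Qed.

Lemma mu_horizon : mu (horizon I) = C%:E.
Proof.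
rewrite /mu lebesgue_measure_itv /= lte_fin deadline_gt0.
by rewrite oppr0 addr0.
Qed.

Lemma integral_horizon_cst (r : \bar R) :
  (\int[mu]_(t in horizon I) cst r t = r * C%:E)%E.
Proof.
rewrite integral_cst; last exact: measurable_horizon.
by congr (_ * _)%E; apply: mu_horizon.
Qed.

(** Jensen's inequality, by integrating the tangent inequality at the mean speed [v = L / C]. *)
Lemma integral_powR_ge (f : R -> R) (L p : R) : 1 < p -> 0 <= L ->
  measurable_fun (horizon I) f -> (forall t, horizon I t -> 0 <= f t) ->
  (\int[mu]_(t in horizon I) (f t)%:E = L%:E)%E ->
  ((L `^ p / C `^ (p - 1))%:E <= \int[mu]_(t in horizon I) (f t `^ p)%:E)%E.
Proof.
move=> p1 L0 mf f0 If; have C0 := deadline_gt0 I.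
have mH := measurable_horizon; pose v := L / C.
have v0 : 0 <= v by rewrite divr_ge0 // ltW.
have mfE : measurable_fun (horizon I) (EFin \o f) by apply/measurable_EFinP.
have mfp : measurable_fun (horizon I) (fun t => (f t `^ p)%:E).
  by apply/measurable_EFinP; apply: (measurableT_comp (measurable_powR p)).
have k0 : 0 <= p * v `^ (p - 1) by rewrite mulr_ge0 ?powR_ge0 //; lra.
have c0 : 0 <= (p - 1) * v `^ p by rewrite mulr_ge0 ?powR_ge0 //; lra.
have fp0 t : horizon I t -> (0 <= (f t `^ p)%:E)%E by rewrite lee_fin powR_ge0.
have cc0 t : horizon I t -> (0 <= cst ((p - 1) * v `^ p)%:E t)%E by rewrite lee_fin.
have : (\int[mu]_(t in horizon I) ((p * v `^ (p - 1))%:E * (f t)%:E) <=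
    \int[mu]_(t in horizon I) ((f t `^ p)%:E + cst ((p - 1) * v `^ p)%:E t))%E.
  apply: ge0_le_integral => //.
  - by move=> t Ht; rewrite -EFinM lee_fin mulr_ge0 // f0.
  - exact: measurable_funeM.
  - by apply: emeasurable_funD => //; exact: measurable_cst.
  - move=> t Ht; rewrite -EFinM /= -EFinD lee_fin -mulrA.
    by apply: powR_tangent => //; apply: f0.
rewrite ge0_integralZl_EFin //.
rewrite (ge0_integralD mu mH fp0 mfp cc0 (measurable_cst _)).
rewrite integral_horizon_cst If.
(* The finite constant term is added on both sides; with it, the left side equals the integrated
   tangent. *)
move=> H; rewrite -(leeD2rE _ _ (x := (((p - 1) * v `^ p)%:E * C%:E)%E)) //.
apply: le_trans H; rewrite -!EFinM -EFinD lee_fin le_eqVlt; apply/orP; left.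
apply/eqP.
have -> : L `^ p / C `^ (p - 1) = v `^ (p - 1) * L.
  rewrite -(mulr_powRB1 L0 (lt_trans ltr01 p1)).
  rewrite /v powRM ?invr_ge0 ?(ltW C0) //.
  have -> : C^-1 `^ (p - 1) = (C `^ (p - 1))^-1.
    by rewrite -powR_inv1 ?(ltW C0) // -powRrM mulN1r powRN.
  by rewrite [L * _]mulrC -!mulrA [L * _]mulrC.
have <- := mulr_powRB1 v0 (lt_trans ltr01 p1).
have -> : L = v * C by rewrite /v divfK // gt_eqF.
by ring.
Qed.

Section Feasible.
Variables (S : schedule R m n).
Hypothesis fS : feasible I S.

Let run i j := horizon I `&` [set t | running S i t = Some j].

Lemma speed_ge0 i t : horizon I t -> 0 <= speed S i t.
Proof.
move=> Ht; case E: (running S i t) => [j|].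
  by case/andP: (feasible_speed fS Ht E) => h _; apply: le_trans h; apply: smin_ge0.
by rewrite (feasible_idle fS Ht E).
Qed.

Lemma speed_le_smax i t : horizon I t -> speed S i t <= smax I.
Proof.
move=> Ht; case E: (running S i t) => [j|].
  by case/andP: (feasible_speed fS Ht E).
by rewrite (feasible_idle fS Ht E) (le_trans (smin_ge0 I) (smin_le_smax I)).
Qed.

(** At each time the speed is charged to the single task running, and an idle processor has speed 0.
    By non-migration only hosted tasks contribute, each its work. *)
Lemma integral_speed i :
  (\int[mu]_(t in horizon I) (speed S i t)%:E = (load I (host S) i)%:E)%E.
Proof.
have mH := measurable_horizon.
have mr j : measurable (run i j) by apply: (feasible_measurable_running fS).
have ms : measurable_fun (horizon I) (fun t => (speed S i t)%:E).
  by apply/measurable_EFinP; apply: (feasible_measurable_speed fS).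
transitivity (\int[mu]_(t in horizon I)
    \sum_(j <- enum 'I_n) ((fun t => (speed S i t)%:E) \_ (run i j)) t)%E.
  apply: eq_integral => t; rewrite inE => Ht; rewrite big_enum /=.
  case E: (running S i t) => [j|]; last first.
    rewrite big1; first by rewrite (feasible_idle fS Ht E).
    move=> j _; rewrite patchE ifF //; apply/negP; rewrite inE => -[_ /=].
    by rewrite E.
  rewrite (bigD1 j) //= big1 ?adde0.
    by rewrite patchE ifT // inE.
  move=> k kj; rewrite patchE ifF //; apply/negP; rewrite inE => -[_ /=].
  by rewrite E => -[E']; rewrite E' eqxx in kj.
rewrite ge0_integral_sum //; first last.
- move=> j t Ht; rewrite patchE; case: ifP => // _.
  by rewrite lee_fin speed_ge0.
- move=> j; apply: (measurable_restrict _ (mr j) mH).1.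
  exact: (measurable_funS mH (@subIsetl _ _ _) ms).
rewrite big_enum /= /load -sumEFin [RHS]big_mkcond /=; apply: eq_bigr => j _.
rewrite -integral_mkcondr /run setIA setIid; case: eqP => [E|ne].
  by have := feasible_work fS j; rewrite E.
rewrite (_ : _ `&` _ = set0) ?integral_set0 //.
apply/seteqP; split=> // t [Ht /= E].
by apply: ne; apply: (feasible_nonmigratory fS Ht E).
Qed.

Lemma load_ge0 a i : 0 <= load I a i.
Proof. by apply: sumr_ge0 => j _; apply/ltW/work_gt0. Qed.

Lemma admissible_host : admissible I (host S).
Proof.
split=> [j|i]; first exact: feasible_host fS j.
rewrite -lee_fin -integral_speed EFinM -integral_horizon_cst.
have mH := measurable_horizon.
apply: ge0_le_integral => //.
- by move=> t Ht; rewrite lee_fin speed_ge0.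
- by apply/measurable_EFinP; apply: (feasible_measurable_speed fS).
- by move=> t Ht; rewrite lee_fin speed_le_smax.
Qed.

Lemma assignment_energy_host :
  ((assignment_energy I (host S))%:E <= energy I S)%E.
Proof.
rewrite /assignment_energy /energy -sumEFin; apply: lee_sum => i _.
apply: integral_powR_ge; [exact: alpha_gt1|exact: load_ge0| | |].
- exact: (feasible_measurable_speed fS).
- by move=> t Ht; apply: speed_ge0.
- exact: integral_speed.
Qed.

End Feasible.
End Energy.

(** * The constant-speed schedule of an assignment *)

Section ConstantSpeed.
Context {R : realType} {m n : nat}.
Variables (I : instance R m n) (a : 'I_n -> 'I_m) (v : 'I_m -> R).
Let mu := @lebesgue_measure R.
Local Notation C := (deadline I).
Hypothesis vE : forall i, v i = load I a i / C.

(** Serves twice: with [Q] the predecessors of a later task on the same processor it orders the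
    execution intervals, with [Q] all tasks of the processor it bounds every finishing time by the
    deadline. *)
Lemma prefix_work_le (j : 'I_n) (Q : pred 'I_n) :
  (forall k : 'I_n, (k < j)%N && (a k == a j) -> Q k) -> Q j ->
  \sum_(k < n | (k < j)%N && (a k == a j)) work I k + work I j <=
    \sum_(k < n | Q k) work I k.
Proof.
move=> sub Qj; rewrite [leRHS](bigD1 j) //= [leLHS]addrC lerD2l.
rewrite big_mkcond [leRHS]big_mkcond; apply: ler_sum => k _.
case: ifP => [H|_]; last by case: ifP => // _; apply/ltW/work_gt0.
rewrite (sub k H) /= ifT //; apply/eqP => E.
by case/andP: H; rewrite E ltnn.
Qed.

Lemma v_gt0 j : 0 < v (a j).
Proof.
rewrite vE divr_gt0 ?deadline_gt0 // /load (bigD1 j) //=.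
by rewrite ltr_pwDl ?work_gt0 // sumr_ge0 // => k _; apply/ltW/work_gt0.
Qed.

Lemma v_ge0 i : 0 <= v i.
Proof. by rewrite vE divr_ge0 ?load_ge0 // ltW // deadline_gt0. Qed.

Lemma start_time_ge0 j : 0 <= start_time I a v j.
Proof.
rewrite divr_ge0 ?v_ge0 // sumr_ge0 // => k _; exact/ltW/work_gt0.
Qed.

Lemma finish_le_start (j k : 'I_n) : (j < k)%N -> a j = a k ->
  start_time I a v j + work I j / v (a j) <= start_time I a v k.
Proof.
move=> jk ajk; rewrite /start_time -mulrDl -ajk ler_pM2r ?invr_gt0 ?v_gt0 //.
apply: prefix_work_le; last by rewrite jk /= eqxx.
by move=> l /andP[lj ->]; rewrite (ltn_trans lj jk).
Qed.

Lemma finish_le_deadline j : start_time I a v j + work I j / v (a j) <= C.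
Proof.
rewrite /start_time -mulrDl ler_pdivrMr ?v_gt0 // vE mulrC divfK.
  by apply: prefix_work_le => // k /andP[].
by rewrite gt_eqF // deadline_gt0.
Qed.

(** The execution intervals on one processor are disjoint, so [pick] has at most one candidate. *)
Lemma constant_speed_runningP i t j :
  constant_speed_running I a v i t = Some j <->
  a j = i /\ start_time I a v j <= t < start_time I a v j + work I j / v i.
Proof.
rewrite /constant_speed_running; split.
  by case: pickP => // k /andP[/eqP ak tk] [<-].
move=> [aj tj]; case: pickP => [k /andP[/eqP ak tk]|/(_ j)]; last by rewrite aj eqxx tj.
suff -> : k = j by [].
case/andP: tj => h1 h2; case/andP: tk => h3 h4; apply: ord_inj.
case: (ltngtP k j) => [lt|lt|//].
  have := finish_le_start lt; rewrite aj ak => /(_ erefl) le.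
  by have := lt_le_trans h4 (le_trans le h1); rewrite ltxx.
have := finish_le_start lt; rewrite aj ak => /(_ erefl) le.
by have := lt_le_trans h2 (le_trans le h3); rewrite ltxx.
Qed.

Lemma horizon_running j :
  horizon I `&` [set t | constant_speed_running I a v (a j) t = Some j] =
  `[start_time I a v j, start_time I a v j + work I j / v (a j)[%classic.
Proof.
apply/seteqP; split=> t /=.
  by move=> [_ /constant_speed_runningP[_]]; rewrite in_itv.
rewrite in_itv /= => H; split; last by apply/constant_speed_runningP.
case/andP: H => h1 h2; rewrite /horizon /= in_itv /=; apply/andP; split.
  exact: le_trans (start_time_ge0 j) h1.
by apply/ltW/(lt_le_trans h2); apply: finish_le_deadline.
Qed.

Lemma measurable_horizon_running i j : measurable
  (horizon I `&` [set t | constant_speed_running I a v i t = Some j]).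
Proof.
have [<-|ne] := pselect (a j = i).
  by rewrite horizon_running; apply: measurable_itv.
rewrite (_ : _ `&` _ = set0) //; apply/seteqP; split=> // t [_ /=].
by case/constant_speed_runningP.
Qed.

Let S := constant_speed_schedule I a v.

Lemma measurable_constant_speed i : measurable_fun (horizon I) (speed S i).
Proof.
have mH := measurable_horizon I.
rewrite (_ : speed S i = fun t =>
    if isSome (constant_speed_running I a v i t) then v i else 0); last first.
  by apply/funext => t /=; case: (constant_speed_running _ _ _ _ _).
apply: measurable_fun_if => //.
apply: (measurable_fun_bool true).
(* The busy times form a finite union of measurable sets, one for each task. *)
rewrite (_ : _ `&` _ = \big[setU/set0]_(j <- enum 'I_n)
    (horizon I `&` [set t | constant_speed_running I a v i t = Some j])).
  by apply: bigsetU_measurable => j _; apply: measurable_horizon_running.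
apply/seteqP; split=> t.
  move=> [Ht /=]; case E: (constant_speed_running I a v i t) => [j|] // _.
  by rewrite -bigcup_seq; exists j => //=; rewrite mem_enum.
by rewrite -bigcup_seq => -[j _ [Ht /= ->]].
Qed.

Lemma speed_constant_le i t : 0 <= speed S i t <= v i.
Proof. by rewrite /=; case: (constant_speed_running _ _ _ _ _) => [_|]; rewrite ?lexx v_ge0. Qed.

Lemma constant_speed_feasible : admissible I a ->
  (forall i, 0 < load I a i -> smin I <= load I a i / C) -> feasible I S.
Proof.
move=> [ael acap] low; split=> /=.
- exact: ael.
- by move=> i j t _ /constant_speed_runningP[].
- move=> i j t _ E; rewrite E; case/constant_speed_runningP: E => aj _.
  rewrite vE low /=; last first.
    by rewrite -aj; have := v_gt0 j; rewrite vE pmulr_lgt0 // invr_gt0 deadline_gt0.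
  by rewrite ler_pdivrMr ?deadline_gt0.
- by move=> i t _ ->.
- exact: measurable_horizon_running.
- exact: measurable_constant_speed.
- move=> j; rewrite horizon_running.
  transitivity (\int[mu]_(t in `[start_time I a v j,
      (start_time I a v j + work I j / v (a j))%R[%classic) cst (v (a j))%:E t)%E.
    apply: eq_integral => t; rewrite inE /= in_itv /= => Ht.
    by have [_ ->] := constant_speed_runningP (a j) t j.
  have h := v_gt0 j.
  have len : mu `[start_time I a v j,
      (start_time I a v j + work I j / v (a j))%R[%classic =
      (work I j / v (a j))%:E.
    rewrite /mu lebesgue_measure_itv /= lte_fin ltrDl divr_gt0 ?work_gt0 //.
    by rewrite -EFinB; congr EFin; ring.
  rewrite integral_cst; last exact: measurable_itv.
  transitivity ((v (a j))%:E * (work I j / v (a j))%:E)%E.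
    by congr (_ * _)%E; apply: len.
  by rewrite -EFinM mulrC divfK // gt_eqF.
Qed.

(** The speed never exceeds [v i], so the energy is at most that of running at [v i] over the whole
    horizon. *)
Lemma energy_constant_speed :
  (energy I S <= (assignment_energy I a)%:E)%E.
Proof.
have p1 := alpha_gt1 I; have p0 : 0 < alpha I by lra.
have C0 := deadline_gt0 I.
rewrite /assignment_energy /energy -sumEFin; apply: lee_sum => i _.
have -> : ((load I a i `^ alpha I / C `^ (alpha I - 1))%:E =
    \int[mu]_(t in horizon I) cst (v i `^ alpha I)%:E t)%E.
  rewrite integral_horizon_cst -EFinM; congr EFin.
  rewrite vE powRM ?load_ge0 ?invr_ge0 ?(ltW C0) // -mulrA; congr (_ * _).
  have -> : C^-1 `^ alpha I = (C `^ alpha I)^-1.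
    by rewrite -powR_inv1 ?(ltW C0) // -powRrM mulN1r powRN.
  rewrite -(mulr_powRB1 (ltW C0) p0) invfM mulrAC mulVf ?mul1r //.
  by rewrite gt_eqF.
have mH := measurable_horizon I.
apply: ge0_le_integral => //.
- by move=> t Ht; rewrite lee_fin powR_ge0.
- apply/measurable_EFinP; apply: (measurableT_comp (measurable_powR _)).
  exact: measurable_constant_speed.
- move=> t Ht; rewrite lee_fin; have /andP[s0 sv] := speed_constant_le i t.
  by apply: ge0_ler_powR; rewrite ?nnegrE ?v_ge0 ?(ltW p0).
Qed.

End ConstantSpeed.

End Schedules.

(** * Convex functions of the loads *)

Local Open Scope ring_scope.

(* A convex function on the naturals is, up to an affine function, a
   nonnegative combination of the functions k |-> (k - d)^+. *)
Lemma convex_decomposition {R : realType} (phi : nat -> R) N k :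
  phi 0%N + k%:R * (phi 1%N - phi 0%N) + \sum_(c < N)
      (phi c.+2 - 2 * phi c.+1 + phi c) * (k - c.+1)%:R =
  if (k <= N)%N then phi k else phi N + (k - N)%:R * (phi N.+1 - phi N).
Proof.
(* Past [N] the partial sum is the linear continuation of [phi]; each induction step corrects its
   slope from [N + 1] on. *)
elim: N => [|N IH].
  rewrite big_ord0 addr0 leqn0 subn0; case: eqP => // ->.
  by rewrite mul0r addr0.
rewrite big_ord_recr /= addrA IH; case: (ltngtP k N.+1) => [lt|lt|->].
- have -> : (k <= N)%N by lia.
  have -> : (k - N.+1 = 0)%N by lia.
  by rewrite mulr0 addr0.
- have -> : (k <= N)%N = false by lia.
  have -> : (k - N = (k - N.+1).+1)%N by lia.
  by rewrite -natr1; ring.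
- by rewrite ltnn subnn subSnn; ring.
Qed.

(** A discrete Karamata inequality: in the decomposition of [phi] the affine parts agree because the
    totals do, and the other coefficients are nonnegative second differences. *)
Lemma sum_convex_le {R : realType} (I : finType) (phi : nat -> R)
    (x y : I -> nat) :
  (forall k, 2 * phi k.+1 <= phi k + phi k.+2) ->
  (\sum_i x i = \sum_i y i)%N ->
  (forall d, \sum_i (x i - d) <= \sum_i (y i - d))%N ->
  \sum_i phi (x i) <= \sum_i phi (y i).
Proof.
move=> cvx exy le; pose N := (\sum_i x i + \sum_i y i)%N.
have dec (z : I -> nat) : (forall i, z i <= N)%N -> \sum_i phi (z i) =
    \sum_(i : I) phi 0%N + (\sum_i z i)%:R * (phi 1%N - phi 0%N) +
    \sum_(c < N) (phi c.+2 - 2 * phi c.+1 + phi c) * (\sum_i (z i - c.+1))%:R.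
  move=> zN; rewrite natr_sum mulr_suml.
  under [X in _ = _ + X]eq_bigr do rewrite natr_sum mulr_sumr.
  rewrite exchange_big /=; transitivity (\sum_i (phi 0%N +
      (z i)%:R * (phi 1%N - phi 0%N) + \sum_(c < N)
        (phi c.+2 - 2 * phi c.+1 + phi c) * (z i - c.+1)%:R)).
    by apply: eq_bigr => i _; rewrite convex_decomposition zN.
  by rewrite !big_split.
have ub (z : I -> nat) i : (z i <= \sum_k z k)%N by rewrite (bigD1 i) //= leq_addr.
rewrite (dec x) => [|i]; last exact: leq_trans (ub x i) (leq_addr _ _).
rewrite (dec y) => [|i]; last exact: leq_trans (ub y i) (leq_addl _ _).
rewrite exy lerD2l; apply: ler_sum => c _; apply: ler_wpM2l; last by rewrite ler_nat.
by have := cvx c; lra.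
Qed.

(** * The logarithmic time bound *)

Lemma ln2_ge {R : realType} : 2^-1 <= ln (2 : R).
Proof.
have h : (-1 : R) < - 2^-1 by lra.
have := le_ln1Dx h; have -> : 1 + - 2^-1 = (2 : R)^-1 by lra.
by rewrite lnV ?posrE //; lra.
Qed.

(** Since ln n >= ln 2 >= 1/2, the truncated logarithm is at most 2 ln n and 7 is at most 14 ln
    n. *)
Lemma trunc_log_le_ln {R : realType} n : (1 < n)%N ->
  (trunc_log 2 n + 7)%:R <= 16 * ln (n%:R : R).
Proof.
move=> n1; have n0 : (0 < n)%N by lia.
have /andP[lo _] := trunc_log_bounds (isT : (1 < 2)%N) n0.
have h2 := @ln2_ge R.
have : (trunc_log 2 n)%:R * ln (2 : R) <= ln (n%:R : R).
  rewrite mulr_natl -lnXn // ler_ln ?posrE ?exprn_gt0 ?ltr0n //.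
  by rewrite -natrX ler_nat.
have : ln (2 : R) <= ln (n%:R : R) by rewrite ler_ln ?posrE ?ltr0n // ler_nat.
rewrite natrD.
have : (trunc_log 2 n)%:R * 2^-1 <= (trunc_log 2 n)%:R * ln (2 : R).
  exact: ler_wpM2l.
by lra.
Qed.

(** The factors n + 2 (twice), m + 1 and n + 1 at most double n, m and n, whence the constant 2 ^ 4
    * 700 = 112 * 100. *)
Lemma budget_le m n : (0 < m)%N -> (1 < n)%N ->
  (n.+2 * round_budget m n (trunc_log 2 n).+1 <=
    112 * 100 * (m * n ^ 3) * (trunc_log 2 n + 7))%N.
Proof.
move=> m0 n1; rewrite /round_budget; set T := trunc_log 2 n.
have h1 : (n.+2 <= 2 * n)%N by lia.
have h2 : (m.+1 * n.+1 <= 2 * m * (2 * n))%N by apply: leq_mul; lia.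
have h3 : (n.+2 * (700 * (m.+1 * n.+1)) <= 2 * n * (700 * (2 * m * (2 * n))))%N.
  by apply: leq_mul => //; apply: leq_mul.
apply: (@leq_trans (2 * n * ((T + 7) * (2 * n * (700 * (2 * m * (2 * n))))))).
  by apply: leq_mul => //; apply: leq_mul => //; lia.
rewrite !expnS expn0; lia.
Qed.

(** * From the program back to scheduling instances *)

Section Instance.
Context {R : realType} {m n : nat}.
Variable I : instance R m n.

Definition elig (i j : nat) : bool :=
  if insub i is Some i' then
    if insub j is Some j' then (i' : 'I_m) \in eligible I (j' : 'I_n) else false
  else false.

Lemma eligE (i : 'I_m) (j : 'I_n) : elig i j = (i \in eligible I j).
Proof. by rewrite /elig !valK. Qed.

Definition nat_assignment (b : 'I_n -> 'I_m) (j : nat) : nat :=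
  if insub j is Some j' then b j' else m.

Lemma nat_assignmentE b (j : 'I_n) : nat_assignment b j = b j.
Proof. by rewrite /nat_assignment valK. Qed.

Lemma legal_nat_assignment b : (forall j, b j \in eligible I j) ->
  legal m n elig (nat_assignment b).
Proof.
move=> eb j jn; rewrite -[j]/(nat_of_ord (Ordinal jn)) nat_assignmentE eligE.
by rewrite eb.
Qed.

Variable w : R.
Hypothesis w0 : 0 < w.
Hypothesis wE : forall j, work I j = w.

Lemma load_cnt (a : 'I_n -> 'I_m) (p : nat -> nat) i :
  (forall j : 'I_n, p j = a j :> nat) ->
  load I a i = w * (cnt n p i)%:R.
Proof.
move=> pa; rewrite /load natr_sum mulr_sumr big_mkcond /=; apply: eq_bigr => j _.
by rewrite pa -(inj_eq val_inj) /= wE; case: eqP; rewrite ?mulr1 ?mulr0.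
Qed.

Lemma assigned_optimally_optimal (a : 'I_n -> 'I_m) (p : nat -> nat) b0 :
  (forall j : 'I_n, p j = a j :> nat) -> assigned_optimally m n elig p ->
  admissible I b0 -> optimal_assignment I a.
Proof.
move=> pa [leg opt] adm0.
have pb b (j : 'I_n) := nat_assignmentE b j.
have le b : admissible I b -> forall d,
    (excess m n d p <= excess m n d (nat_assignment b))%N.
  by move=> [eb _] d; apply/opt/legal_nat_assignment.
split; first split=> [j|i].
- by rewrite -eligE -pa; have [] := leg j (ltn_ord j).
- have m0 : (0 < #|'I_m|)%N by rewrite card_ord; apply: leq_ltn_trans (ltn_ord i).
  (* For the capacity bound take as [d] the largest load [c i0] of the admissible [b0]. The excess
     of [b0] vanishes, hence so does that of [p], and no load of [p] exceeds [c i0]. *)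
  pose c k := cnt n (nat_assignment b0) (nat_of_ord (k : 'I_m)).
  have [i0 Ei0] := bigop.eq_bigmax c m0.
  have := le b0 adm0 (c i0); rewrite [leqRHS]big1; last first.
    by move=> k _; apply/eqP; rewrite subn_eq0 -Ei0; apply: bigop.leq_bigmax.
  rewrite leqn0 sum_nat_eq0 => /forall_inP/(_ i isT); rewrite subn_eq0 => ci.
  rewrite (load_cnt _ pa); have [_ /(_ i0)] := adm0.
  rewrite (load_cnt _ (pb b0)); apply: le_trans.
  by rewrite ler_pM2l // ler_nat.
- move=> b adm; rewrite /assignment_energy -!mulr_suml.
  rewrite ler_pM2r ?invr_gt0 ?powR_gt0 ?deadline_gt0 //.
  under eq_bigr do rewrite (load_cnt _ pa).
  under [leRHS]eq_bigr do rewrite (load_cnt _ (pb b)).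
  apply: (@sum_convex_le _ _ (fun k => (w * k%:R) `^ alpha I)
    (fun i : 'I_m => cnt n p i) (fun i : 'I_m => cnt n (nat_assignment b) i)).
  + move=> k; rewrite !powRM ?(ltW w0) //.
    have := powR_midpoint (ler0n R k) (alpha_gt1 I).
    rewrite natr1 -[k%:R + 2]natrD addn2 => h.
    by rewrite mulrCA -mulrDr ler_pM2l // powR_gt0.
  + rewrite !sum_cnt // => j jn.
      by have [] := legal_nat_assignment adm.1 jn.
    by have [] := leg j jn.
  + exact: le.
Qed.

End Instance.

Theorem theorem1 :
  exists K : nat,
  forall (R : realType) (m n : nat) (I : instance R m n) (s : state R),
    (forall j k : 'I_n, work I j = work I k) ->
    encodes I s ->
    exists (t : nat) (s' : state R),
      [/\ exec ECSEMRPP_Algo s t s',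
          (1 < n)%N ->
            t%:R <= K%:R * (m%:R * n%:R ^+ 3 * ln n%:R) :> R
        & (exists S : schedule R m n, feasible I S) ->
          smin_not_binding I ->
          exists (a : 'I_n -> 'I_m) (v : 'I_m -> R),
            returns s' a v /\ optimal I (constant_speed_schedule I a v)].
Proof.
(* The constant of [budget_le] times that of [trunc_log_le_ln]. *)
exists (112 * 100 * 16)%N => R m n I s eqw [Em En Ee Ew EC].
have [w w0 wE] : exists2 w, 0 < w & forall j, work I j = w.
  case: (pickP (fun _ : 'I_n => true)) => [j _|no].
    by exists (work I j) => [|k]; [exact: work_gt0|exact: eqw].
  (* Without tasks any positive [w] will do. *)
  by exists 1 => // j; have := no j.
(* The eligibility sets are nonempty, so an eligible assignment exists whether or not the speed
   limits allow a feasible schedule; the analysis of the run starts from it. *)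
have lb0 := legal_nat_assignment (fun j => xchooseP (eligible_ex I j)).
have Ee' i j : (i < m)%N -> (j < n)%N ->
    nmem s "elig"%string (i * n + j) = nat_of_bool (elig I i j).
  by move=> im jn; rewrite (Ee (Ordinal im) (Ordinal jn)) -eligE.
have nL : (n <= 2 ^ (trunc_log 2 n).+1)%N.
  case: (posnP n) => [->//|n0].
  by have /andP[_ /ltnW] := trunc_log_bounds (isT : (1 < 2)%N) n0.
have [t [s' [ex le [opt sp]]]] := runs_algo lb0 Em En Ee' nL.
exists t, s'; split=> // [n1|[S fS] low].
  have m0 : (0 < m)%N.
    have [i _] := eligible_ex I (Ordinal (ltnW n1)).
    exact: leq_ltn_trans (ltn_ord i).
  have : (t <= 112 * 100 * (m * n ^ 3) * (trunc_log 2 n + 7))%N.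
    exact: leq_trans le (budget_le m0 n1).
  rewrite -(ler_nat R) => /le_trans; apply.
  rewrite natrM; apply: le_trans (ler_wpM2l (ler0n _ _) (trunc_log_le_ln n1)) _.
  by rewrite !(natrX, natrM) le_eqVlt; apply/orP; left; apply/eqP; ring.
have leg := opt.1.
pose a (j : 'I_n) : 'I_m := Ordinal (leg j (ltn_ord j)).1.
pose v i := load I a i / deadline I.
have oa : optimal_assignment I a.
  exact: (assigned_optimally_optimal w0 wE _ opt (admissible_host fS)).
exists a, v; split.
  split=> // i; rewrite sp // /v /load EC; congr (_ / _).
  by apply: eq_big => [j|j _]; [rewrite -(inj_eq val_inj)|rewrite Ew].
(* [smin_not_binding] applies because the computed assignment is itself optimal. *)
split; first by apply: constant_speed_feasible => //; [case: oa|exact: low].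
(* The chain is: energy of the computed schedule, assignment energy of [a], assignment energy of the
   hosts of [S'], energy of [S']. *)
move=> S' fS'; apply: le_trans (energy_constant_speed (fun=> erefl)) _.
apply: le_trans (assignment_energy_host fS'); rewrite lee_fin.
by apply: oa.2; apply: admissible_host.
Qed.
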